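(* Let $d\ge 2$. For every $S>0$ (with $S<\infty$), one has $\lambda_{det}(S)>0$.
   Context: Fix $d\ge 2$. For $\lambda\ge 0$, let $\Pi=\{p_j\}_{j\ge1}$ be a Poisson point process of intensity $\lambda$ on $\mathbb{Z}^d$ (i.e. the numbers of points at the different vertices are i.i.d. Poisson random variables of mean $\lambda$); its points are called particles and are labelled arbitrarily by positive integers. Let $\eta_j(0)$ be the initial position of particle $p_j$. Let $(\zeta_j(t))_{t\ge0}$, $j\ge1$, be independent continuous-time simple symmetric random walks on $\mathbb{Z}^d$ with jump rate $1$ started at the origin, independent of $\Pi$. The position of particle $p_j$ at time $t$ is $\eta_j(t)=\eta_j(0)+\zeta_j(t)$. A target starts at the origin at time $0$. Let $\|\cdot\|$ denote the $\ell_1$ norm. Let $\mathcal{P}$ be the set of functions $g:\mathbb{R}_+\to\mathbb{Z}^d$ with $g(0)=0$ such that for all $t\ge0$ and $\xi>0$, if $\|g(t+\xi)-g(t)\|>1$ then there is $\xi'\in(0,\xi)$ with $\|g(t+\xi')-g(t)\|<\|g(t+\xi)-g(t)\|$. For $0<S<\infty$, let $$\mathcal{P}_S=\{g\in\mathcal{P}:\ \|g(t+\xi)-g(t)\|\le \max(\xi S,1)\ \text{ for all } t\ge0,\ \xi>0\}$$ be the set of trajectories with maximum speed $S$. For $g\in\mathcal{P}$ the detection time is $$T_{det}(g)=\inf\{t\ge0:\ g(t)=\eta_k(t)\text{ for some }k\ge1\},\qquad \inf\emptyset=\infty.$$ The target may choose its trajectory depending on the past, present and future positions of all particles. Accordingly,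 $$\lambda_{det}(S)=\inf\{\lambda\ge0:\ \text{almost surely, } T_{det}(g)<\infty\text{ for all } g\in\mathcal{P}_S\},$$ where ''almost surely'' means that the stated property holds outside a set contained in an event of probability $0$ (and $\inf\emptyset=\infty$). *)

(* Defs.v *)
From HB Require Import structures.
From mathcomp Require Import all_boot all_order all_algebra.
From mathcomp Require Import all_classical all_reals all_analysis.

Set Implicit Arguments.
Unset Strict Implicit.
Unset Printing Implicit Defensive.

Import Order.TTheory GRing.Theory Num.Theory.
Import numFieldNormedType.Exports.
Local Open Scope classical_set_scope.
Local Open Scope ring_scope.

Notation lattice d := 'rV[int]_d.

Definition l1norm (d : nat) (x : lattice d) : nat :=
  (\sum_(i < d) absz (x ord0 i))%N.

(* The library's poisson_pmf takes the junk value 1 at rate 0; this one is the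
   Dirac mass at 0 there (0 ^+ 0 = 1), as needed for intensity 0 and for
   increments over an empty time interval. *)
Definition poisson_mass (R : realType) (r : R) (k : nat) : R :=
  r ^+ k / k`!%:R * expR (- r).

Section Randomness.
Context (disp : measure_display) (T : measurableType disp) (R : realType).
Variable P : probability T R.

Definition mutually_independent (I : eqType) (F : I -> set (set T)) : Prop :=
  forall (s : seq I) (A : I -> set T), uniq s ->
    (forall i, i \in s -> F i (A i)) ->
    P (\bigcap_(i in [set` s]) A i) = (\prod_(i <- s) P (A i))%E.

(* Random elements below take countably many values, so they are measurable for
   the discrete sigma-algebra as soon as the events {X = v} are measurable, and
   the sigma-algebra they generate consists of all preimages. *)
Definition discrete_rv (V : Type) (X : T -> V) : Prop :=
  forall v, measurable (X @^-1` [set v]).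

Definition sigma_rv (V : Type) (X : T -> V) : set (set T) :=
  range (fun B : set V => X @^-1` B).

Definition sigma_process (V J : Type) (D : set J) (X : J -> T -> V) :
    set (set T) :=
  <<s \bigcup_(i in D) sigma_rv (X i) >>.

Definition nonneg_times : set R := [set t | 0 <= t].

Record poisson_process (N : R -> T -> nat) : Prop := PoissonProcess {
  pp_measurable : forall t : R, 0 <= t -> discrete_rv (N t);
  pp_start : forall w, N 0 w = 0%N;
  pp_monotone : forall w (s t : R), 0 <= s -> s <= t -> (N s w <= N t w)%N;
  pp_right_continuous : forall w (t : R), 0 <= t ->
    \forall u \near t^'+, N u w = N t w;
  pp_independent_increments : forall t : nat -> R,
    0 <= t 0%N -> (forall i, t i <= t i.+1) ->
    mutually_independent
      (fun i => sigma_rv (fun w => N (t i.+1) w - N (t i) w)%N);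
  pp_poisson_increments : forall (s t : R) k, 0 <= s -> s <= t ->
    P [set w | (N t w - N s w)%N = k] = (poisson_mass (t - s) k)%:E }.

Record srw_steps (d : nat) (xi : nat -> T -> lattice d) : Prop := SrwSteps {
  steps_measurable : forall n, discrete_rv (xi n);
  steps_independent : mutually_independent (fun n => sigma_rv (xi n));
  steps_uniform : forall n (e : lattice d), l1norm e = 1%N ->
    P [set w | xi n w = e] = ((2 * d)%:R^-1)%:E }.

Definition ct_srw (d : nat) (zeta : R -> T -> lattice d) : Prop :=
  exists (N : R -> T -> nat) (xi : nat -> T -> lattice d),
    [/\ poisson_process N,
        srw_steps xi,
        mutually_independent (fun o : option nat =>
          if o is Some n then sigma_rv (xi n)
          else sigma_process nonneg_times N) &
        forall (t : R) w, 0 <= t -> zeta t w = \sum_(n < N t w) xi n w].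

(* A label j with eta0 j w = None is not used by any particle: the number of
   particles may be finite (there is none at all at intensity 0). *)
Definition occupation (d : nat) (eta0 : nat -> T -> option (lattice d))
    (x : lattice d) (w : T) : \bar R :=
  counting [set j | eta0 j w = Some x].

Record poisson_points (d : nat) (lambda : R)
    (eta0 : nat -> T -> option (lattice d)) : Prop := PoissonPoints {
  pts_measurable : forall j, discrete_rv (eta0 j);
  pts_independent : mutually_independent (fun x => sigma_rv (occupation eta0 x));
  pts_poisson : forall x k,
    P [set w | occupation eta0 x w = k%:R%:E] = (poisson_mass lambda k)%:E }.

End Randomness.

Record particle_system (R : realType) (d : nat) (lambda : R) :=
  ParticleSystem {
    ps_disp : measure_display;
    ps_space : measurableType ps_disp;
    ps_prob : probability ps_space R;
    ps_eta0 : nat -> ps_space -> option (lattice d);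
    ps_zeta : nat -> R -> ps_space -> lattice d;
    ps_points : poisson_points ps_prob lambda ps_eta0;
    ps_walks : forall j, ct_srw ps_prob (ps_zeta j);
    ps_independent : mutually_independent ps_prob (fun o : option nat =>
      if o is Some j then sigma_process (@nonneg_times R) (ps_zeta j)
      else sigma_process [set: nat] ps_eta0) }.
Arguments ps_eta0 {R d lambda} _ j w.
Arguments ps_zeta {R d lambda} _ j t w.

(* Only the values of g on nonnegative times matter. *)
Definition trajectory (R : realType) (d : nat) (g : R -> lattice d) : Prop :=
  g 0 = 0 /\
  forall t xi : R, 0 <= t -> 0 < xi -> (1 < l1norm (g (t + xi) - g t)%R)%N ->
    exists xi' : R, [/\ 0 < xi', xi' < xi &
      (l1norm (g (t + xi') - g t)%R < l1norm (g (t + xi) - g t)%R)%N].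

Definition trajectory_speed (R : realType) (d : nat) (S : R)
    (g : R -> lattice d) : Prop :=
  trajectory g /\
  forall t xi : R, 0 <= t -> 0 < xi ->
    (l1norm (g (t + xi) - g t))%:R <= Num.max (xi * S) 1.

Definition detected_at (R : realType) (d : nat) (lambda : R)
    (M : particle_system d lambda) (w : ps_space M) (g : R -> lattice d)
    (t : R) : Prop :=
  exists j x, ps_eta0 M j w = Some x /\ g t = x + ps_zeta M j t w.

Definition Tdet (R : realType) (d : nat) (lambda : R)
    (M : particle_system d lambda) (w : ps_space M) (g : R -> lattice d) :
    \bar R :=
  ereal_inf [set t%:E | t in [set t | 0 <= t /\ detected_at w g t]].

Definition as_always_detected (R : realType) (d : nat) (S lambda : R)
    (M : particle_system d lambda) : Prop :=
  {ae ps_prob M, forall w, forall g, trajectory_speed S g ->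
    (Tdet w g < +oo)%E}.

Definition lambda_det (R : realType) (d : nat)
    (M : forall lambda : {nonneg R}, particle_system d lambda%:num) (S : R) :
    \bar R :=
  ereal_inf [set lambda%:num%:E | lambda in
    [set lambda : {nonneg R} | as_always_detected S (M lambda)]].

(* Main.v *)
(** The target runs ballistically along the first axis and dodges along the
second one. At scale [L] it spends a time of order [L] in each block, during
which a particle only diffuses over a distance of order [sqrt L]; hence a
particle meets only few of the space-time boxes (sites [(i, h)], visited by the
target in time block [i] at height about [h L]) and the number of sites it meets
has exponential moments of any prescribed order once [L] is large. Since the
initial configuration is Poisson, a Chernoff bound then shows that, for small
[lambda], any [k] given sites are all closed (met by some particle) with
probability at most [144 ^- k].

An open Lipschitz path of heights [F] is obtained as in Lipschitz percolation:
[F i] is the least height not reached by paths that go up into closed sites and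
go down diagonally for free. If the origin is not reached then [F 0 = 0] and
all sites [(i, F i)] are open; a union bound over the paths makes this
event of positive probability, and on it the target following [F] is never
detected. *)

Require Import Defs.
From mathcomp Require Import all_boot all_order all_algebra.
From mathcomp Require Import all_classical all_reals all_analysis.
From mathcomp Require Import measurable_realfun.
From mathcomp Require Import ring lra zify.
Set Implicit Arguments.
Unset Strict Implicit.
Unset Printing Implicit Defensive.
Import Order.TTheory GRing.Theory Num.Theory.
Import numFieldNormedType.Exports.
Local Open Scope classical_set_scope.
Local Open Scope ring_scope.

(** * Uniform steps of the walk *)

(** One particle may close many sites, so the sites are not independent; what replaces independence
    is a bound, exponential in [size A], on the probability that all sites of a prescribed finite
    list [A] are closed. For a walk from [x], let [phi x] be a bound on the mean of [z] to the
    number of sites of [A] it meets, minus 1. Summed over all [x] this is at most [C * size A],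
    since along a fixed path only boundedly many starting points bring a given position into a given
    box. Poisson occupation numbers turn the sum into [expR (lambda * C * size A)], to be set
    against [z ^+ size A].

    The labelling of the particles is arbitrary, so the labelled positions [eta0 j] need not be
    independent of each other. The walks are therefore integrated first with all initial positions
    frozen, and only then are the particles regrouped by starting point.

    The value [144 = 12 ^ 2] comes from counting: more than half of the vertices of a loop-free path
    from the origin are distinct closed sites, so [n] steps cost at least a factor [12 ^- n] against
    [3 ^ n] paths. *)

Lemma poisson_mass_ge0 (R : realType) (r : R) k : 0 <= r -> 0 <= poisson_mass r k.
Proof.
by move=> r0; rewrite /poisson_mass mulr_ge0 ?expR_ge0// divr_ge0// exprn_ge0.
Qed.

Lemma poisson_pgf (R : realType) (r s : R) : 0 <= r -> 0 <= s ->
  (\sum_(k <oo) (poisson_mass r k * s ^+ k)%:E)%E = (expR (r * (s - 1)))%:E.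
Proof.
move=> r0 s0.
rewrite [LHS](_ : _ = (\sum_(k <oo) ((expR (- r))%:E * (exp_coeff (r * s) k)%:E))%E); last first.
  apply: eq_eseriesr => k _; rewrite -EFinM /poisson_mass /exp_coeff/= exprMn.
  by congr (_%:E); ring.
rewrite nneseriesZl; last first.
  by move=> k _; rewrite lee_fin exp_coeff_ge0// mulr_ge0.
have -> : (\sum_(0 <= k <oo) (exp_coeff (r * s) k)%:E)%E = (expR (r * s))%:E.
  rewrite /expR -EFin_lim; last exact: is_cvg_series_exp_coeff.
  apply: congr_lim; apply/funext => n /=.
  by rewrite /series/= -sumEFin.
by rewrite -EFinM -expRD; congr (expR _)%:E; ring.
Qed.

Section Model.
Variables (R : realType) (d : nat).
Local Notation lat := (lattice d.+2).

Definition dir := ('I_d.+2 * bool)%type.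
Definition sgdir (s : bool) : int := if s then 1 else -1.
Definition step (u : dir) : lat := sgdir u.2 *: delta_mx ord0 u.1.
Definition disp (b : seq dir) : lat := \sum_(u <- b) step u.
Definition c0 : 'I_d.+2 := ord0.
Definition c1 : 'I_d.+2 := @Ordinal d.+2 1 isT.
(** Only the two axes along which the target moves are tracked: distinct boxes differ in these
    coordinates alone. *)
Definition max_disp (b : seq dir) : nat :=
  \max_(l < (size b).+1)
    maxn (absz (disp (take l b) ord0 c0)) (absz (disp (take l b) ord0 c1)).

Lemma stepE u c : step u ord0 c = if u.1 == c then sgdir u.2 else 0.
Proof.
rewrite /step !mxE eqxx andTb eq_sym.
by case: eqP; rewrite ?mulr1 ?mulr0.
Qed.

Lemma disp_cat b b' : disp (b ++ b') = disp b + disp b'.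
Proof. by rewrite /disp big_cat. Qed.

Local Open Scope ereal_scope.

Definition step_prob : R := ((2 * d.+2)%:R^-1)%R.

Lemma step_prob_ge0 : (0 <= step_prob)%R. Proof. by rewrite invr_ge0. Qed.

(** The expectation over [k] independent uniform steps, by recursion on words rather than on a
    probability space. *)
Fixpoint avg (k : nat) (f : seq dir -> \bar R) : \bar R :=
  if k is k'.+1 then \sum_(u : dir) step_prob%:E * avg k' (fun b => f (u :: b))
  else f [::].

Lemma avg_ge0 k f : (forall b, 0 <= f b) -> 0 <= avg k f.
Proof.
elim: k f => [|k IH] f f0 //=; apply: sume_ge0 => u _.
by rewrite mule_ge0 ?lee_fin ?step_prob_ge0 ?IH.
Qed.

Lemma le_avg k f g : (forall b, size b = k -> f b <= g b) -> avg k f <= avg k g.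
Proof.
elim: k f g => [|k IH] f g fg /=; first exact: fg.
apply: lee_sum => u _; apply: lee_wpmul2l; first by rewrite lee_fin step_prob_ge0.
by apply: IH => b sb; apply: fg; rewrite /= sb.
Qed.

Lemma eq_avg k f g : (forall b, size b = k -> f b = g b) -> avg k f = avg k g.
Proof.
by move=> fg; apply/eqP; rewrite eq_le !le_avg// => b /fg ->.
Qed.

Lemma avgD k f g : (forall b, 0 <= f b) -> (forall b, 0 <= g b) ->
  avg k (fun b => f b + g b) = avg k f + avg k g.
Proof.
elim: k f g => [|k IH] f g f0 g0 //=.
rewrite -big_split/=; apply: eq_bigr => u _.
rewrite IH// ge0_muleDr//; exact: avg_ge0.
Qed.

Lemma avgZ k f (x : \bar R) : (forall b, 0 <= f b) -> 0 <= x ->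
  avg k (fun b => x * f b) = x * avg k f.
Proof.
elim: k f => [|k IH] f f0 x0 //=.
rewrite ge0_sume_distrr; last first.
  by move=> u _; rewrite mule_ge0 ?lee_fin ?step_prob_ge0 ?avg_ge0.
by apply: eq_bigr => u _; rewrite IH// muleCA.
Qed.

Lemma card_dir : #|{: dir}| = (2 * d.+2)%N.
Proof. by rewrite card_prod card_ord card_bool mulnC. Qed.

Lemma sum_step_prob : \sum_(u : dir) step_prob%:E = 1.
Proof.
rewrite sumEFin sumr_const card_dir -mulr_natr mulVf//.
Qed.

Lemma avg_cst k (x : \bar R) : 0 <= x -> avg k (fun=> x) = x.
Proof.
move=> x0; elim: k => [|k IH] //=; rewrite IH -ge0_sume_distrl.
  by rewrite sum_step_prob mul1e.
by move=> u _; rewrite lee_fin step_prob_ge0.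
Qed.

(** * Exponential moments of the maximal displacement *)

Section Weights.
Variable h : R.
Hypothesis h1 : (1 <= h)%R.

Definition stepw (c : 'I_d.+2) (s : bool) (u : dir) : R :=
  (if u.1 == c then if u.2 == s then h else h^-1 else 1)%R.

(** Expanded, this is the sum over all prefixes of [h] to the signed displacement along [c]. It
    dominates each of these powers, and its mean is computed one step at a time, which replaces a
    maximal inequality. *)
Fixpoint prefixw c s (b : seq dir) : R :=
  (if b is u :: b' then 1 + stepw c s u * prefixw c s b' else 1)%R.

Let h0 : (0 < h)%R. Proof. exact: lt_le_trans h1. Qed.

Lemma stepw_ge0 c s u : (0 <= stepw c s u)%R.
Proof.
rewrite /stepw; case: ifP => _ //; case: ifP => _; first exact: ltW.
by rewrite invr_ge0 ltW.
Qed.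

Lemma prefixw_ge0 c s b : (0 <= prefixw c s b)%R.
Proof.
by elim: b => [|u b IH] /=; rewrite ?addr_ge0 ?mulr_ge0 ?stepw_ge0.
Qed.

Lemma stepw_exp c s u : stepw c s u = (h ^ (sgdir s * step u ord0 c))%R.
Proof.
rewrite /stepw stepE; case: ifP => _; last by rewrite mulr0 expr0z.
by case: s; case: u.2; rewrite /= ?mulr1 ?mul1r ?mulrN1 ?opprK ?expr1z // exprN1.
Qed.

Lemma prefixw_ge c s b l :
  (h ^ (sgdir s * disp (take l b) ord0 c) <= prefixw c s b)%R.
Proof.
elim: b l => [|u b IH] [|l] /=; rewrite ?take0 /disp ?big_nil ?mxE ?mulr0 ?expr0z //.
  by rewrite lerDl mulr_ge0 ?stepw_ge0 ?prefixw_ge0.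
rewrite big_cons mxE mulrDr expfzDr ?gt_eqF// -stepw_exp.
rewrite ler_wpDl// ler_wpM2l ?stepw_ge0//; exact: IH.
Qed.

Lemma exp_max_disp b : (h ^+ max_disp b <=
  \sum_(c <- [:: c0; c1]) \sum_(s : bool) prefixw c s b)%R.
Proof.
have key c l : (h ^+ absz (disp (take l b) ord0 c) <=
    \sum_(s : bool) prefixw c s b)%R.
  rewrite big_bool /=.
  have [z0|z0] := leP 0%R (disp (take l b) ord0 c).
    have := prefixw_ge c true b l; rewrite /= mul1r -{1}(gez0_abs z0) => H.
    by apply: (le_trans H); rewrite lerDl prefixw_ge0.
  have := prefixw_ge c false b l; rewrite /= mulN1r -(ltz0_abs z0) => H.
  by apply: (le_trans H); rewrite lerDr prefixw_ge0.
rewrite /max_disp; have [l ->] : exists l : 'I_(size b).+1, (\max_(l < (size b).+1)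
    maxn (absz (disp (take l b) ord0 c0)) (absz (disp (take l b) ord0 c1)))%N =
    maxn (absz (disp (take l b) ord0 c0)) (absz (disp (take l b) ord0 c1)).
  have [] := @bigop.eq_bigmax _ (fun l : 'I_(size b).+1 =>
    maxn (absz (disp (take l b) ord0 c0)) (absz (disp (take l b) ord0 c1))).
    by rewrite card_ord.
  by move=> l ->; exists l.
have s0 c : (0 <= \sum_(s : bool) prefixw c s b)%R.
  by apply: sumr_ge0 => s _; exact: prefixw_ge0.
rewrite !big_cons big_nil addr0; rewrite /maxn; case: ifP => _.
  by rewrite (le_trans (key c1 l))// lerDr.
by rewrite (le_trans (key c0 l))// lerDl.
Qed.

(** The hyperbolic cosine of the logarithm of [h]. *)
Definition cosh_base : R := ((h + h^-1) / 2)%R.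

Lemma cosh_base_ge1 : (1 <= cosh_base)%R.
Proof.
rewrite /cosh_base ler_pdivlMr// mul1r -subr_ge0.
rewrite (_ : (h + h^-1 - 2) = (h - 1) ^+ 2 / h)%R; last by field; rewrite gt_eqF.
by rewrite divr_ge0 ?sqr_ge0 ?ltW.
Qed.

(** A step moves along [c] with probability [1 / d.+2] only; since [cosh_base] is at least 1,
    pretending that it always does gives an upper bound free of the dimension. *)
Lemma mean_stepw c s : (\sum_(u : dir) step_prob * stepw c s u <= cosh_base)%R.
Proof.
have -> : (\sum_(u : dir) step_prob * stepw c s u = step_prob * (2 * cosh_base + (2 * d.+1)%:R))%R.
  rewrite -mulr_sumr; congr (_ * _)%R.
  transitivity (\sum_(i : 'I_d.+2) \sum_(t : bool) stepw c s (i, t))%R.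
    by rewrite pair_big; apply: eq_bigr => -[].
  rewrite (bigD1 c)//=; congr (_ + _)%R.
    rewrite big_bool /stepw /= eqxx /cosh_base mulrC divfK ?pnatr_eq0//.
    by case: s => /=; rewrite // addrC.
  transitivity (\sum_(i : 'I_d.+2 | i != c) (2 : R))%R.
    apply: eq_bigr => i ic; rewrite big_bool /stepw /= (negbTE ic).
    by rewrite -(natrD R 1 1).
  by rewrite sumr_const cardC1 card_ord natrM mulr_natr.
rewrite /step_prob mulrC ler_pdivrMr ?ltr0n//.
rewrite !natrM -(natr1 d.+1).
have : (0 <= (cosh_base - 1) * d.+1%:R)%R by rewrite mulr_ge0 ?subr_ge0 ?cosh_base_ge1.
by set X := cosh_base; set D := (d.+1)%:R; nra.
Qed.

Lemma avg_prefixw k c s :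
  avg k (fun b => (prefixw c s b)%:E) <= (k.+1%:R * cosh_base ^+ k)%:E.
Proof.
elim: k => [|k IH] /=; first by rewrite expr0 mulr1.
have -> : \sum_(u : dir) step_prob%:E * avg k (fun b => (1 + stepw c s u * prefixw c s b)%:E)
  = \sum_(u : dir) (step_prob%:E + (step_prob * stepw c s u)%:E * avg k (fun b => (prefixw c s b)%:E)).
  apply: eq_bigr => u _.
  under eq_avg => b _ do rewrite EFinD EFinM.
  rewrite avgD//; last by move=> b; rewrite -EFinM lee_fin mulr_ge0 ?stepw_ge0 ?prefixw_ge0.
  rewrite avg_cst// avgZ ?lee_fin ?stepw_ge0//.
    rewrite ge0_muleDr// ?mule1 ?muleA//.
    rewrite mule_ge0 ?lee_fin ?stepw_ge0 ?avg_ge0// => b; rewrite lee_fin; exact: prefixw_ge0.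
  by move=> b; rewrite lee_fin; exact: prefixw_ge0.
rewrite big_split/= sum_step_prob -ge0_sume_distrl; last first.
  by move=> u _; rewrite lee_fin mulr_ge0 ?step_prob_ge0 ?stepw_ge0.
rewrite sumEFin.
apply: (@le_trans _ _ (1 + cosh_base%:E * (k.+1%:R * cosh_base ^+ k)%:E)).
  apply: leeD2l; apply: lee_pmul => //.
  - rewrite lee_fin; apply: sumr_ge0 => u _; by rewrite mulr_ge0 ?step_prob_ge0 ?stepw_ge0.
  - by apply: avg_ge0 => b; rewrite lee_fin; exact: prefixw_ge0.
  - by rewrite lee_fin mean_stepw.
rewrite -EFinM -EFinD lee_fin -(natr1 k.+1) mulrDl mul1r exprS addrC mulrCA.
by rewrite lerD2l -exprS exprn_ege1// cosh_base_ge1.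
Qed.

(** The factor [(size b).+1] counts the positions visited in the block and is needed later by
    [sum_hit]. The 4 stands for two axes and two signs; the second [k.+1] is the number of
    prefixes. *)
Lemma avg_max_disp k :
  avg k (fun b => ((size b).+1%:R * h ^+ max_disp b)%:E) <=
  (4 * k.+1%:R ^+ 2 * cosh_base ^+ k)%:E.
Proof.
apply: (@le_trans _ _ (avg k (fun b => k.+1%:R%:E *
  (\sum_(c <- [:: c0; c1]) \sum_(s : bool) prefixw c s b)%:E))).
  apply: le_avg => b ->; rewrite -EFinM lee_fin ler_wpM2l//.
  exact: exp_max_disp.
have P0 c s b : 0 <= (prefixw c s b)%:E by rewrite lee_fin prefixw_ge0.
rewrite avgZ ?lee_fin//; last first.
  move=> b; rewrite lee_fin !sumr_ge0// => c _.
  by rewrite sumr_ge0// => s _; exact: prefixw_ge0.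
under eq_avg => b _ do rewrite !big_cons big_nil addr0 !big_bool !EFinD.
rewrite !avgD//; try by move=> b; rewrite adde_ge0.
apply: (@le_trans _ _ (k.+1%:R%:E * ((k.+1%:R * cosh_base ^+ k)%:E + (k.+1%:R * cosh_base ^+ k)%:E
   + ((k.+1%:R * cosh_base ^+ k)%:E + (k.+1%:R * cosh_base ^+ k)%:E)))).
  apply: lee_wpmul2l; first by rewrite lee_fin.
  by rewrite !leeD ?avg_prefixw.
by rewrite -!EFinD -EFinM lee_fin le_eqVlt; apply/orP; left; apply/eqP; ring.
Qed.

End Weights.

End Model.

(** * Independent Poisson blocks of steps *)

Section BlockExpectation.
Variables (R : realType) (d : nat) (T : R).
Hypothesis T0 : 0 <= T.
Local Open Scope ereal_scope.
Implicit Types f g : seq (dir d) -> \bar R.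

(* A walk during a time interval of length [T] is encoded by the list of its
   steps: Poisson many, and uniform given their number. *)
Definition Eblock f : \bar R := \sum_(k <oo) (poisson_mass T k)%:E * avg k f.

Let pm0 k : 0 <= (poisson_mass T k)%:E.
Proof. by rewrite lee_fin poisson_mass_ge0. Qed.

Let term0 f k : (forall b, 0 <= f b) -> 0 <= (poisson_mass T k)%:E * avg k f.
Proof. by move=> f0; rewrite mule_ge0// avg_ge0. Qed.

Lemma Eblock_ge0 f : (forall b, 0 <= f b) -> 0 <= Eblock f.
Proof. by move=> f0; apply: nneseries_ge0 => k _ _; exact: term0. Qed.

Lemma le_Eblock f g : (forall b, 0 <= f b) -> (forall b, f b <= g b) -> Eblock f <= Eblock g.
Proof.
move=> f0 fg; apply: lee_nneseries => [k _ _|k _]; first exact: term0.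
by apply: lee_wpmul2l => //; apply: le_avg => b _.
Qed.

Lemma eq_Eblock f g : (forall b, f b = g b) -> Eblock f = Eblock g.
Proof. by move=> /funext ->. Qed.

Lemma EblockD f g : (forall b, 0 <= f b) -> (forall b, 0 <= g b) ->
  Eblock (fun b => f b + g b) = Eblock f + Eblock g.
Proof.
move=> f0 g0; rewrite /Eblock -nneseriesD; try by move=> k _ _; exact: term0.
by apply: eq_eseriesr => k _; rewrite avgD// ge0_muleDr// avg_ge0.
Qed.

Lemma EblockZ f (x : R) : (forall b, 0 <= f b) -> (0 <= x)%R ->
  Eblock (fun b => x%:E * f b) = x%:E * Eblock f.
Proof.
move=> f0 x0; rewrite /Eblock -nneseriesZl; last by move=> k _; exact: term0.
by apply: eq_eseriesr => k _; rewrite avgZ// muleCA.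
Qed.

Lemma Eblock_cst (x : R) : (0 <= x)%R -> Eblock (fun=> x%:E) = x%:E.
Proof.
move=> x0; have := @poisson_pgf R T 1 T0 ler01.
rewrite subrr mulr0 expR0 => P1.
transitivity (x%:E * \sum_(k <oo) (poisson_mass T k * 1 ^+ k)%:E).
  rewrite /Eblock -nneseriesZl; last by move=> k _; rewrite lee_fin mulr_ge0// poisson_mass_ge0.
  by apply: eq_eseriesr => k _; rewrite avg_cst ?lee_fin// muleC expr1n mulr1.
by rewrite P1 mule1.
Qed.

(* Since [(k+1) e <= (1+e)^k], the polynomial prefactor is absorbed into a
   slightly larger Poisson generating function. *)
Lemma Eblock_max_disp (h e : R) : (1 <= h)%R -> (0 < e <= 1)%R ->
  Eblock (fun b => ((size b).+1%:R * h ^+ max_disp b)%:E) <=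
  (4 / e ^+ 2 * expR (T * ((1 + e) ^+ 2 * cosh_base h - 1)))%:E.
Proof.
move=> h1 /andP[e0 e1].
have c1 := cosh_base_ge1 h1.
have c0 : (0 <= cosh_base h)%R by exact: le_trans c1.
have bern k : (k.+1%:R * e <= (1 + e) ^+ k)%R.
  elim: k => [|k IH]; first by rewrite mul1r expr0.
  rewrite exprSr -natr1 mulrDl mul1r mulrDr mulr1.
  apply: lerD => //; rewrite ler_peMl// ?(ltW e0)//.
  by rewrite exprn_ege1// lerDl ltW.
rewrite EFinM -(@poisson_pgf R T _ T0); last by rewrite mulr_ge0// exprn_ge0// addr_ge0// ltW.
rewrite -nneseriesZl; last first.
  move=> k _; rewrite lee_fin mulr_ge0// ?poisson_mass_ge0// exprn_ge0//.
  by rewrite mulr_ge0// exprn_ge0// addr_ge0// ltW.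
apply: lee_nneseries => [k _ _|k _].
  by apply: term0 => b; rewrite lee_fin mulr_ge0// exprn_ge0// (le_trans ler01).
apply: (@le_trans _ _ ((poisson_mass T k)%:E * (4 * k.+1%:R ^+ 2 * cosh_base h ^+ k)%:E)).
  by apply: lee_wpmul2l => //; exact: avg_max_disp.
rewrite -!EFinM lee_fin [leRHS]mulrCA ler_wpM2l ?poisson_mass_ge0//.
rewrite [in leRHS]exprMn [leRHS]mulrA ler_wpM2r ?exprn_ge0// -[leRHS]mulrA.
rewrite ler_wpM2l// -ler_pdivrMl ?invr_gt0 ?exprn_gt0// invrK.
rewrite -exprM mulnC exprM -exprMn mulrC; apply: lerXn2r; rewrite ?nnegrE.
- by rewrite mulr_ge0// ltW.
- by rewrite exprn_ge0// addr_ge0// ltW.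
- exact: bern.
Qed.

Fixpoint Eblocks (M : nat) (G : seq (seq (dir d)) -> \bar R) : \bar R :=
  if M is M'.+1 then Eblock (fun b => Eblocks M' (fun bs => G (b :: bs))) else G [::].

Lemma Eblocks_ge0 M G : (forall bs, 0 <= G bs) -> 0 <= Eblocks M G.
Proof.
elim: M G => [|M IH] G G0 //=; apply: Eblock_ge0 => b; exact: IH.
Qed.

Lemma le_Eblocks M F G : (forall bs, 0 <= F bs) -> (forall bs, size bs = M -> F bs <= G bs) ->
  Eblocks M F <= Eblocks M G.
Proof.
elim: M F G => [|M IH] F G F0 FG /=; first exact: FG.
apply: le_Eblock => b; first exact: Eblocks_ge0.
by apply: IH => // bs sbs; apply: FG; rewrite /= sbs.
Qed.

Lemma EblocksD M F G : (forall bs, 0 <= F bs) -> (forall bs, 0 <= G bs) ->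
  Eblocks M (fun bs => F bs + G bs) = Eblocks M F + Eblocks M G.
Proof.
elim: M F G => [|M IH] F G F0 G0 //=.
under eq_Eblock => b do rewrite IH//.
by rewrite EblockD// => b; exact: Eblocks_ge0.
Qed.

Lemma EblocksZ M G (x : R) : (forall bs, 0 <= G bs) -> (0 <= x)%R ->
  Eblocks M (fun bs => x%:E * G bs) = x%:E * Eblocks M G.
Proof.
elim: M G => [|M IH] G G0 x0 //=.
under eq_Eblock => b do rewrite IH//.
by rewrite EblockZ// => b; exact: Eblocks_ge0.
Qed.

Lemma Eblocks_cst M (x : R) : (0 <= x)%R -> Eblocks M (fun=> x%:E) = x%:E.
Proof.
by move=> x0; elim: M => [|M IH] //=; rewrite IH Eblock_cst.
Qed.

Lemma Eblocks_sum M (I : Type) (s : seq I) (P : pred I) (F : I -> seq (seq (dir d)) -> \bar R) :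
  (forall i bs, 0 <= F i bs) ->
  Eblocks M (fun bs => \sum_(i <- s | P i) F i bs) = \sum_(i <- s | P i) Eblocks M (F i).
Proof.
move=> F0; elim: s => [|i s IH].
  rewrite big_nil; transitivity (Eblocks M (fun=> 0%:E)); last exact: Eblocks_cst.
  by congr Eblocks; apply/funext => bs; rewrite big_nil.
rewrite big_cons; case: ifPn => Pi.
  rewrite -IH -EblocksD//; last by move=> bs; apply: sume_ge0.
  by congr Eblocks; apply/funext => bs; rewrite big_cons Pi.
by rewrite -IH; congr Eblocks; apply/funext => bs; rewrite big_cons (negbTE Pi).
Qed.

(** Independence of the blocks is built into the nesting of expectations; blocks outside the window
    integrate to 1. *)
Lemma Eblocks_window (w : seq (dir d) -> R) (q : R) M i n :
  (forall b, 0 <= w b)%R -> (0 <= q)%R ->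
  Eblock (fun b => (w b)%:E) <= q%:E -> (i + n < M)%N ->
  Eblocks M (fun bs => (\prod_(i <= m < (i + n).+1) w (nth [::] bs m))%:E) <= (q ^+ n.+1)%:E.
Proof.
move=> w0 q0 wq.
have base n' M' : (n' < M')%N ->
    Eblocks M' (fun bs => (\prod_(0 <= m < n'.+1) w (nth [::] bs m))%:E) <= (q ^+ n'.+1)%:E.
  elim: n' M' => [|n' IH] [|M'] // nM /=.
    rewrite (_ : (fun b => _) = (fun b => (w b)%:E)) ?expr1//.
    apply/funext => b; rewrite -[RHS](@Eblocks_cst M')//.
    by congr Eblocks; apply/funext => bs; rewrite big_nat1.
  apply: (@le_trans _ _ (Eblock (fun b => (q ^+ n'.+1)%:E * (w b)%:E))).
    apply: le_Eblock => [b|b].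
      by apply: Eblocks_ge0 => bs; rewrite lee_fin prodr_ge0.
    rewrite (_ : (fun bs => _) = (fun bs : seq (seq (dir d)) =>
        (w b)%:E * (\prod_(0 <= m < n'.+1) w (nth [::] bs m))%:E)); last first.
      by apply/funext => bs; rewrite big_nat_recl.
    rewrite EblocksZ//; last by move=> bs; rewrite lee_fin prodr_ge0.
    rewrite [leRHS]muleC; apply: lee_wpmul2l; first by rewrite lee_fin.
    exact: IH.
  rewrite EblockZ//; last by rewrite exprn_ge0.
  rewrite [leRHS](_ : _ = (q ^+ n'.+1)%:E * q%:E); last by rewrite -EFinM -exprSr.
  apply: lee_wpmul2l => //.
  by rewrite lee_fin exprn_ge0.
elim: i M => [|i IH] [|M] // iM; first exact: base.
rewrite /= (_ : (fun b => _) = fun b => Eblocks M (fun bs =>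
    (\prod_(i <= m < (i + n).+1) w (nth [::] bs m))%:E)).
  apply: (@le_trans _ _ (Eblock (fun=> (q ^+ n.+1)%:E))).
    apply: le_Eblock => [b|b]; last exact: IH.
    by apply: Eblocks_ge0 => bs; rewrite lee_fin prodr_ge0.
  by rewrite Eblock_cst// exprn_ge0.
apply/funext => b; congr Eblocks; apply/funext => bs.
by rewrite addSn big_add1.
Qed.

End BlockExpectation.

(** * Sites met by a walk *)

(* [zify] does not see matrix entries as atoms. *)
Ltac lia_entries :=
  repeat match goal with
  | |- context [@fun_of_matrix ?R ?m ?n ?A ?i ?j] =>
      let u := fresh "u" in move: (@fun_of_matrix R m n A i j) => u
  end; lia.

Section Hits.
Variables (d L : nat).
Hypothesis L0 : (0 < L)%N.
Local Notation lat := (lattice d.+2).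
Local Notation c0 := (c0 d).
Local Notation c1 := (c1 d).

(** A block that the target starts at height [a.2 * L] may end one level up or down, so the box
    extends by [L] both ways. *)
Definition box (a : nat * nat) (y : lat) : bool :=
  [&& (a.1 * L)%N%:Z <= y ord0 c0, y ord0 c0 <= (a.1.+1 * L)%N%:Z,
      (a.2 * L)%N%:Z - L%:Z <= y ord0 c1, y ord0 c1 <= (a.2.+1 * L)%N%:Z &
      [forall c, (c != c0) && (c != c1) ==> (y ord0 c == 0)]].

Definition box_size : nat := (L.+1 * (2 * L).+1)%N.

Lemma card_box (a : nat * nat) (s : seq lat) :
  uniq s -> {in s, forall y, box a y} -> (size s <= box_size)%N.
Proof.
move=> us sb.
pose f (u : nat * nat) : lat := \row_c
  (if c == c0 then (a.1 * L + u.1)%N%:Z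
   else if c == c1 then (a.2 * L + u.2)%N%:Z - L%:Z else 0).
pose t := [seq f u | u <- allpairs pair (iota 0 L.+1) (iota 0 (2 * L).+1)].
have -> : box_size = size t by rewrite size_map size_allpairs !size_iota.
apply: uniq_leq_size => // y /sb /and5P[h1 h2 h3 h4 /forallP h5].
apply/mapP; exists (absz (y ord0 c0 - (a.1 * L)%N%:Z)%R,
                    absz (y ord0 c1 - ((a.2 * L)%N%:Z - L%:Z))%R).
  apply/allpairsP; exists (absz (y ord0 c0 - (a.1 * L)%N%:Z)%R,
                    absz (y ord0 c1 - ((a.2 * L)%N%:Z - L%:Z))%R).
  rewrite !mem_iota /=; split=> //.
    by move: h1 h2; rewrite mulSn; lia.
  by move: h3 h4; rewrite mulSn; lia.
apply/rowP => c; rewrite -[LHS]/(y ord0 c) mxE /=; case: eqP => [->|/eqP cc0]; first by lia.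
case: eqP => [->|/eqP cc1]; first by lia.
by have := h5 c; rewrite cc0 cc1 => /eqP.
Qed.

Definition hit (x : lat) (bs : seq (seq (dir d))) (a : nat * nat) : bool :=
  (a.1 < size bs)%N &&
  [exists l : 'I_(size (nth [::] bs a.1)).+1,
     box a (x + disp (flatten (take a.1 bs)) + disp (take l (nth [::] bs a.1)))].

(** The path is fixed and the starting points are counted: each position of the path in the block
    translates [K] injectively, and at most [box_size] translates fall in the box. This keeps the
    sum over all starting points finite. *)
Lemma sum_hit (K : seq lat) bs a : uniq K ->
  (\sum_(x <- K) hit x bs a <= box_size * (size (nth [::] bs a.1)).+1)%N.
Proof.
move=> uK; set b := nth [::] bs a.1.
pose p l x := box a (x + disp (flatten (take a.1 bs)) + disp (take l b)).
apply: (@leq_trans (\sum_(l < (size b).+1) count (p l) K)).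
  have -> : (\sum_(l < (size b).+1) count (p l) K =
             \sum_(x <- K) \sum_(l < (size b).+1) p l x)%N.
    rewrite exchange_big/=; apply: eq_bigr => l _.
    by rewrite -sum1_count big_mkcond; apply: eq_bigr => x _; case: p.
  apply: leq_sum => x _; rewrite /hit; case: andP => [[_ /existsP[l Hl]]|//].
  by rewrite (bigD1 l)//= {1}/p Hl.
rewrite mulnC -[X in (_ <= X * _)%N]card_ord -sum_nat_const; apply: leq_sum => l _.
pose c := disp (flatten (take a.1 bs)) + disp (take l b).
rewrite -size_filter -(size_map (fun x => x + c)).
apply: (@card_box a).
  rewrite map_inj_uniq ?filter_uniq//; exact: addIr.
move=> y /mapP[x]; rewrite mem_filter => /andP[px _] ->.
by rewrite /c addrA.
Qed.

Lemma disp_take_max_disp (b : seq (dir d)) l : (l <= size b)%N ->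
  (absz (disp (take l b) ord0 c0) <= max_disp b)%N /\
  (absz (disp (take l b) ord0 c1) <= max_disp b)%N.
Proof.
move=> lb; have := @leq_bigmax _ (fun l : 'I_(size b).+1 =>
  maxn (absz (disp (take l b) ord0 c0)) (absz (disp (take l b) ord0 c1)))
  (Ordinal (lb : (l < (size b).+1)%N)).
by rewrite /= geq_max => /andP[].
Qed.

Lemma flatten_takeS (T : Type) (bs : seq (seq T)) k :
  flatten (take k.+1 bs) = flatten (take k bs) ++ nth [::] bs k.
Proof.
by elim: bs k => [|b bs IH] [|k] //=; rewrite ?take0 ?cats0// IH catA.
Qed.

Lemma disp_flatten_take (bs : seq (seq (dir d))) i n :
  (absz (disp (flatten (take (i + n) bs)) ord0 c0 -
         disp (flatten (take i bs)) ord0 c0)%R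
   <= \sum_(i <= m < i + n) max_disp (nth [::] bs m))%N.
Proof.
elim: n => [|n IH]; first by rewrite addn0 big_geq// subrr.
rewrite addnS big_nat_recr/= ?leq_addr// flatten_takeS disp_cat mxE.
have [+ _] := @disp_take_max_disp (nth [::] bs (i + n)) _ (leqnn _).
rewrite take_size; move: IH; set s := bigop _ _ _.
lia_entries.
Qed.

(** The two positions are compared through block boundaries: back to the start of block [a.1],
    forward over whole blocks, then into block [a'.1]. Block [a.1] is used twice, hence the factor
    2; the final [L] is the width of a box. *)
Lemma hit_spread x bs a a' : hit x bs a -> hit x bs a' -> (a.1 <= a'.1)%N ->
  ((a'.1 - a.1) * L <= 2 * \sum_(a.1 <= m < a'.1.+1) max_disp (nth [::] bs m) + L)%N.
Proof.
move=> /andP[_ /existsP[l /and5P[_ h2 _ _ _]]].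
move=> /andP[_ /existsP[l' /and5P[h1 _ _ _ _]]] aa'.
have [Hl _] := @disp_take_max_disp (nth [::] bs a.1) l (ltn_ord l).
have [Hl' _] := @disp_take_max_disp (nth [::] bs a'.1) l' (ltn_ord l').
have := disp_flatten_take bs a.1 (a'.1 - a.1); rewrite subnKC// => Hf.
have e1 : (\sum_(a.1 <= m < a'.1.+1) max_disp (nth [::] bs m) =
  \sum_(a.1 <= m < a'.1) max_disp (nth [::] bs m) + max_disp (nth [::] bs a'.1))%N.
  by rewrite big_nat_recr.
have e2 : (max_disp (nth [::] bs a.1) <= \sum_(a.1 <= m < a'.1.+1) max_disp (nth [::] bs m))%N.
  by rewrite big_nat_recl// leq_addr.
move: h1 h2; rewrite !mxE mulSn mulnBl.
have := leq_mul aa' (leqnn L).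
move: Hl Hl' Hf e1 e2.
set s := bigop _ _ _; set s' := bigop _ _ _; lia_entries.
Qed.

(** Positions within one block differ by at most twice its maximal displacement, and the 2 accounts
    for the vertical extent [2 * L] of a box. *)
Lemma hit_column x bs a a' : hit x bs a -> hit x bs a' -> a.1 = a'.1 ->
  (a.2 <= a'.2 + (2 + (2 * max_disp (nth [::] bs a.1)) %/ L))%N.
Proof.
move=> /andP[_ /existsP[l /and5P[_ _ h3 _ _]]].
move=> /andP[_ /existsP[l' /and5P[_ _ _ h4 _]]] aa'.
move: l' h4; rewrite -aa' => l' h4.
have [_ Hl] := @disp_take_max_disp (nth [::] bs a.1) l (ltn_ord l).
have [_ Hl'] := @disp_take_max_disp (nth [::] bs a.1) l' (ltn_ord l').
set V := max_disp _ in Hl Hl' *.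
rewrite -leq_subLR -leq_subLR leq_divRL//.
have : ((a.2 * L)%N%:Z <= (a'.2 * L)%N%:Z + 2 * L%:Z + 2 * V%:Z).
  move: h3 h4 Hl Hl'; rewrite !mxE mulSn; lia_entries.
rewrite !mulnBl; lia.
Qed.

(** * Weights of the columns crossed by a path *)

Section Weighted.
Variable R : realType.
Variables z g : R.
Hypothesis z1 : 1 <= z.
Hypothesis g1 : 1 <= g.
Hypothesis zg : z <= g ^+ L.

Let g0 : 0 < g. Proof. exact: lt_le_trans g1. Qed.
Let z0 : 0 < z. Proof. exact: lt_le_trans z1. Qed.

(** The part [z ^+ 5 * g ^+ (4 * max_disp b)] pays for the sites met inside one column
    ([column_count]); the remaining [g ^+ (2 * max_disp b) / g ^+ L], multiplied over a window of
    columns, is bounded below through [hit_spread]. *)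
Definition column_weight (b : seq (dir d)) : R := z ^+ 5 * g ^+ (6 * max_disp b) / g ^+ L.

Lemma column_weight_ge0 b : 0 <= column_weight b.
Proof. by rewrite !mulr_ge0 ?invr_ge0 ?exprn_ge0 ?(ltW z0) ?(ltW g0). Qed.

Lemma column_count x bs (A : seq (nat * nat)) m : uniq A ->
  z ^+ count (fun a => hit x bs a && (a.1 == m)) A <=
  z ^+ 5 * g ^+ (4 * max_disp (nth [::] bs m)).
Proof.
move=> uA; set p := fun a => _; set V := max_disp _.
have -> : count p A = size (seq.filter p A) by rewrite size_filter.
case E : (seq.filter p A) => [|a0 s].
  by rewrite expr0 -(mulr1 1) ler_pM// exprn_ege1.
have a0A : a0 \in seq.filter p A by rewrite E mem_head.
set q := ((2 * V) %/ L)%N.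
(* All sites met in this column have heights within [2 + q] of that of [a0], an interval of
   [5 + 2 * q] integers. *)
have sz : (size (seq.filter p A) <= 5 + 2 * q)%N.
  rewrite -(size_map snd) -(size_iota (a0.2 - (2 + q)) (5 + 2 * q)).
  apply: uniq_leq_size.
    rewrite map_inj_in_uniq ?filter_uniq// => -[u1 u2] [v1 v2].
    by rewrite !mem_filter /p /= => /andP[/andP[_ /eqP->] _] /andP[/andP[_ /eqP->] _] ->.
  move=> h /mapP[a aA ->]; rewrite mem_iota.
  move: aA a0A; rewrite !mem_filter /p => /andP[/andP[ha /eqP am] _] /andP[/andP[ha0 /eqP a0m] _].
  have := hit_column ha ha0; rewrite am a0m => /(_ erefl).
  have := hit_column ha0 ha; rewrite am a0m => /(_ erefl).
  rewrite -/V -/q; lia.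
rewrite -E; apply: (le_trans (ler_weXn2l z1 sz)).
rewrite exprD ler_wpM2l ?exprn_ge0 ?(ltW z0) ?(ltW g0)//.
(* Hypothesis [zg] trades each [z] for [g ^+ L], and [q * L <= 2 * V] turns the exponent into
   [4 * V]. *)
apply: (@le_trans _ _ (g ^+ (L * (2 * q)))).
  by rewrite [leRHS]exprM lerXn2r ?nnegrE ?exprn_ge0 ?(ltW z0) ?(ltW g0).
apply: ler_weXn2l => //.
have := leq_trunc_div (2 * V) L; rewrite -/q; lia.
Qed.

(* A walk meeting sites in columns [i] and [i + n] travels at least [(n - 1) L],
   which pays the factor [g ^ - L] per column. *)
Lemma exp_count_hit x bs (A : seq (nat * nat)) : uniq A ->
  z ^+ count (hit x bs) A - 1 <=
  \sum_(a <- A) \sum_(n < size bs - a.1)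
    (hit x bs a)%:R * (g ^+ (2 * L) * \prod_(a.1 <= m < (a.1 + n).+1) column_weight (nth [::] bs m)).
Proof.
move=> uA.
have P0 i j : 0 <= \prod_(i <= m < j) column_weight (nth [::] bs m).
  by apply: prodr_ge0 => m _; exact: column_weight_ge0.
have S0 a : 0 <= \sum_(n < size bs - a.1) (hit x bs a)%:R *
    (g ^+ (2 * L) * \prod_(a.1 <= m < (a.1 + n).+1) column_weight (nth [::] bs m)).
  by apply: sumr_ge0 => n _; rewrite !mulr_ge0 ?exprn_ge0 ?(ltW z0) ?(ltW g0).
have [hA|/hasPn hA] := boolP (has (hit x bs) A); last first.
  rewrite (_ : count _ _ = 0%N) ?subrr ?sumr_ge0//.
  by apply/eqP; rewrite -leqn0 leqNgt -has_count; apply/hasPn.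
pose Q m := has (fun a => hit x bs a && (a.1 == m)) A.
have exQ : exists m, Q m.
  by case/hasP: hA => a aA ha; exists a.1; apply/hasP; exists a; rewrite ?ha ?eqxx.
have bQ m : Q m -> (m <= size bs)%N.
  by case/hasP => a _ /andP[/andP[+ _] /eqP <-] => /ltnW.
case: (ex_minnP exQ) => i /hasP[a aA /andP[ha /eqP ai]] imin.
case: (ex_maxnP exQ bQ) => i' /hasP[a' aA' /andP[ha' /eqP ai']] imax.
have ii' : (i <= i')%N by apply: imin; apply/hasP; exists a'; rewrite ?ha' ?ai' ?eqxx.
have cnt : count (hit x bs) A =
  (\sum_(i <= m < i'.+1) count (fun a => hit x bs a && (a.1 == m)) A)%N.
  rewrite -sum1_count big_mkcond.
  transitivity (\sum_(a <- A) \sum_(i <= m < i'.+1) (hit x bs a && (a.1 == m)))%N.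
    rewrite big_seq [RHS]big_seq; apply: eq_bigr => e eA.
    have [he|he] := boolP (hit x bs e); last by rewrite big1.
    have ei : (i <= e.1 < i'.+1)%N.
      by rewrite imin ?ltnS ?imax//; apply/hasP; exists e; rewrite ?he ?eqxx.
    rewrite (bigD1_seq e.1) ?mem_index_iota ?iota_uniq//= eqxx big1// => m.
    by rewrite eq_sym => /negbTE ->.
  rewrite exchange_big/=; apply: eq_bigr => m _.
  by rewrite -sum1_count [RHS]big_mkcond; apply: eq_bigr => e _; case: andP.
have iM : (i' - i < size bs - a.1)%N.
  have /andP[+ _] := ha'; rewrite ai' ai => i'M.
  by rewrite ltn_sub2r// (leq_ltn_trans ii').
apply: (@le_trans _ _ (z ^+ count (hit x bs) A)).
  by rewrite lerBlDr lerDl.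
(* One term of the double sum suffices: a site [a] met in the first column [i], and the window
   reaching exactly to the last column [i']. *)
rewrite (bigD1_seq a)//= -[leLHS]addr0 lerD//; last first.
  by apply: sumr_ge0 => e _; exact: S0.
rewrite (bigD1 (Ordinal iM))//= -[leLHS]addr0 lerD//; last first.
  by apply: sumr_ge0 => n _; rewrite !mulr_ge0 ?exprn_ge0 ?(ltW z0) ?(ltW g0).
rewrite ha mul1r ai subnKC// cnt.
set Vs := (\sum_(i <= m < i'.+1) max_disp (nth [::] bs m))%N.
have spr : ((i' - i) * L <= 2 * Vs + L)%N.
  by have := hit_spread ha ha'; rewrite ai ai' => /(_ ii').
have -> : \prod_(i <= m < i'.+1) column_weight (nth [::] bs m) =
    \prod_(i <= m < i'.+1) (z ^+ 5 * g ^+ (4 * max_disp (nth [::] bs m))) *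
    g ^+ (2 * Vs) / g ^+ ((i' - i).+1 * L).
  rewrite /Vs big_distrr/= expr_sum; set P := \prod_(_ <= _ < _) (_ * _).
  have -> : g ^+ ((i' - i).+1 * L) = \prod_(i <= m < i'.+1) g ^+ L.
    by rewrite prodr_const_nat -exprM mulnC subSn.
  rewrite -prodfV /P -!big_split/=; apply: eq_bigr => m _.
  by rewrite /column_weight; congr (_ / _); rewrite -[RHS]mulrA -exprD -mulnDl.
rewrite expr_sum.
apply: (@le_trans _ _ (\prod_(i <= m < i'.+1) (z ^+ 5 * g ^+ (4 * max_disp (nth [::] bs m))))).
  apply: ler_prod => m _; rewrite exprn_ge0 ?(ltW z0) ?(ltW g0)//=; exact: column_count.
set P := \prod_(_ <= _ < _) _.
have P1 : 0 <= P by apply: prodr_ge0 => m _; rewrite mulr_ge0 ?exprn_ge0 ?(ltW z0) ?(ltW g0).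
rewrite -!mulrA mulrCA -[leLHS]mulr1 ler_wpM2l//.
(* By [spr], [(i' - i).+1 * L] is at most [2 * L + 2 * Vs]: the prefactor [g ^+ (2 * L)] covers the
   box width lost in [hit_spread] and the one column by which the window exceeds [i' - i]. *)
rewrite mulrA -exprD ler_pdivlMr ?exprn_gt0// mul1r ler_weXn2l//.
by move: spr; rewrite mulSn; clear; lia.
Qed.

Lemma sum_exp_count_hit (K : seq lat) bs (A : seq (nat * nat)) : uniq K -> uniq A ->
  \sum_(x <- K) (z ^+ count (hit x bs) A - 1) <=
  \sum_(a <- A) \sum_(n < size bs - a.1) (box_size%:R * g ^+ (2 * L)) *
    \prod_(a.1 <= m < (a.1 + n).+1)
       ((size (nth [::] bs m)).+1%:R * column_weight (nth [::] bs m)).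
Proof.
move=> uK uA.
apply: (@le_trans _ _ (\sum_(x <- K) \sum_(a <- A) \sum_(n < size bs - a.1)
    (hit x bs a)%:R * (g ^+ (2 * L) * \prod_(a.1 <= m < (a.1 + n).+1) column_weight (nth [::] bs m)))).
  by apply: ler_sum => x _; exact: exp_count_hit.
rewrite exchange_big/=; apply: ler_sum => a _.
rewrite exchange_big/=; apply: ler_sum => n _.
rewrite -mulr_suml -natr_sum mulrCA [leRHS]mulrAC mulrC ler_wpM2r//.
  by rewrite exprn_ge0 ?(ltW g0).
have P0 i j : 0 <= \prod_(i <= m < j) column_weight (nth [::] bs m).
  by apply: prodr_ge0 => m _; exact: column_weight_ge0.
rewrite [X in _ <= _ * X]big_split/= [leRHS]mulrA ler_wpM2r//.
apply: (@le_trans _ _ (box_size * (size (nth [::] bs a.1)).+1)%:R).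
  by rewrite ler_nat sum_hit.
(* Only the first block of the window needs its number of positions; the factors of the other blocks
   are at least 1 and are included so that all blocks carry the same weight. *)
rewrite natrM ler_wpM2l// big_nat_recl ?leq_addr//= ler_peMr//.
elim/big_ind: _ => //; first by move=> u v u1 v1; rewrite -(mulr1 1) ler_pM.
by move=> m _; rewrite ler1n.
Qed.

End Weighted.
End Hits.

(** * Exponential moments of the number of sites met *)

Section HitExpectation.
Variables (R : realType) (d L : nat) (T z g : R).
Hypothesis L0 : (0 < L)%N.
Hypothesis T0 : 0 <= T.
Hypothesis z1 : 1 <= z.
Hypothesis g1 : 1 <= g.
Hypothesis zg : z <= g ^+ L.

Definition block_weight (b : seq (dir d)) : R := (size b).+1%:R * column_weight L z g b.

Hypothesis half : (Eblock T (fun b => (block_weight b)%:E) <= (2^-1)%:E)%E.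

(** Subtracting 1 leaves no contribution from paths that meet nothing, so that the sum over starting
    points can stay bounded. *)
Definition excess (M : nat) (A : seq (nat * nat)) (x : lattice d.+2) : \bar R :=
  Eblocks T M (fun bs => (z ^+ count (hit L x bs) A - 1)%:E).

Lemma excess_ge0 M A x : (0 <= excess M A x)%E.
Proof. by apply: Eblocks_ge0 => // bs; rewrite lee_fin subr_ge0 exprn_ege1. Qed.

Lemma sum_geo_half n : \sum_(i < n) (2^-1 : R) ^+ i.+1 <= 1.
Proof.
have -> : \sum_(i < n) (2^-1 : R) ^+ i.+1 = 1 - 2^-1 ^+ n.
  elim: n => [|n IH]; first by rewrite big_ord0 expr0 subrr.
  by rewrite big_ord_recr/= IH exprS; field.
by rewrite gerBl exprn_ge0.
Qed.

(** By [half], a window of [n.+1] columns weighs at most [2^-1 ^+ n.+1], so all windows starting at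
    a given site together cost at most 1. The bound is linear in [size A] and uniform in [M] and
    [K]. *)
Lemma sum_excess M A (K : seq (lattice d.+2)) : uniq K -> uniq A ->
  (\sum_(x <- K) excess M A x <= (box_size L * size A)%:R%:E * (g ^+ (2 * L))%:E)%E.
Proof.
move=> uK uA; rewrite /excess -Eblocks_sum//; last first.
  by move=> x bs; rewrite lee_fin subr_ge0 exprn_ege1.
have g0 : 0 <= g by rewrite (le_trans _ g1).
have w0 b : 0 <= block_weight b by rewrite mulr_ge0 ?column_weight_ge0.
have C0 : 0 <= (box_size L)%:R * g ^+ (2 * L) by rewrite mulr_ge0 ?exprn_ge0.
have W0 i j (bs : seq (seq (dir d))) :
    (0 <= (\prod_(i <= m < j) block_weight (nth [::] bs m))%:E)%E.
  by rewrite lee_fin prodr_ge0.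
apply: (@le_trans _ _ (Eblocks T M (fun bs =>
  \sum_(a <- A) \sum_(n < M - a.1) ((box_size L)%:R * g ^+ (2 * L))%:E *
    (\prod_(a.1 <= m < (a.1 + n).+1) block_weight (nth [::] bs m))%:E)%E)).
  apply: le_Eblocks => // bs; first by rewrite sume_ge0// => x _; rewrite lee_fin subr_ge0 exprn_ege1.
  move=> sM; rewrite sumEFin.
  have := sum_exp_count_hit L0 z1 g1 zg bs uK uA; rewrite -lee_fin => /le_trans; apply.
  rewrite -sumEFin; apply: lee_sum => a _.
  by rewrite -sumEFin sM; apply: lee_sum => n _; rewrite EFinM.
rewrite Eblocks_sum//; last first.
  by move=> a bs; rewrite sume_ge0// => n _; rewrite mule_ge0.
apply: (@le_trans _ _ (\sum_(a <- A) ((box_size L)%:R * g ^+ (2 * L))%:E)%E); last first.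
  by rewrite sumEFin -EFinM lee_fin big_const_seq count_predT iter_addr_0 natrM [leRHS]mulrAC mulr_natr.
apply: lee_sum => a _; rewrite Eblocks_sum//; last by move=> n bs; rewrite mule_ge0.
apply: (@le_trans _ _ (\sum_(n < M - a.1) ((box_size L)%:R * g ^+ (2 * L) * 2^-1 ^+ n.+1)%:E)%E).
  apply: lee_sum => n _; rewrite EblocksZ// [leRHS]EFinM; apply: lee_wpmul2l; first by rewrite lee_fin.
  by apply: Eblocks_window => //; have := ltn_ord n; lia.
by rewrite sumEFin lee_fin -mulr_sumr ler_piMr// sum_geo_half.
Qed.

End HitExpectation.

(** The inequality [1 + x <= expR x] at [u] and [- u] bounds the hyperbolic cosine by
    [(1 - u ^+ 2)^-1], which is at most [1 + 2 * u ^+ 2] for small [u]. *)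
Lemma cosh_base_expR (R : realType) (u : R) : 0 <= u <= 2^-1 -> cosh_base (expR u) <= 1 + 2 * u ^+ 2.
Proof.
move=> /andP[u0 u1]; rewrite /cosh_base -expRN.
have p1 := expR_ge1Dx u; have p2 := expR_ge1Dx (- u).
have e0 := expR_gt0 u; have e1 := expR_gt0 (- u).
have pe : expR u * expR (- u) = 1 by rewrite expRN mulfV// gt_eqF.
have q1 : expR u * (1 - u) <= 1.
  by rewrite -[leRHS]pe ler_wpM2l// ltW.
have q2 : expR (- u) * (1 + u) <= 1.
  by rewrite -[leRHS]pe mulrC ler_wpM2r// ltW.
rewrite ler_pdivrMr//.
have uu : u ^+ 2 <= 4^-1 by nra.
have q3 : (expR u + expR (- u)) * (1 - u ^+ 2) <= 2 by nra.
have : 0 < 1 - u ^+ 2 by lra.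
move: (expR u + expR (- u)) q3 => X q3 v0.
rewrite -(ler_pM2r v0) (le_trans q3)//.
nra.
Qed.

(* With block length [L] and duration [tau * L], a walk typically moves about
   [sqrt (tau * L)], much less than [L]. *)
Lemma exists_scale (R : realType) (d : nat) (tau z : R) : 0 < tau -> 1 <= z ->
  exists L : nat, exists g : R, [/\ (0 < L)%N, 1 <= g, z <= g ^+ L &
    (Eblock (tau * L%:R) (fun b : seq (dir d) => (block_weight L z g b)%:E) <= (2^-1)%:E)%E].
Proof.
move=> tau0 z1.
(* The rate is [g = expR e]. The 12 puts [6 * e] in the range of [cosh_base_expR], the 6 being the
   exponent in [column_weight]. The 154 is twice the 77 below: displacements then cost at most
   [expR (e * L%:R / 2)], half in exponent of the gain [g ^- L]. *)
pose e : R := (12 + 154 * tau)^-1.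
have den0 : 0 < 12 + 154 * tau by nra.
have e0 : 0 < e by rewrite invr_gt0.
have e12 : e * 12 <= 1 by rewrite /e mulrC ler_pdivrMr// mul1r; nra.
have e1 : e <= 1 by lra.
have et : 154 * tau * e <= 1 by rewrite /e ler_pdivrMr// mul1r; nra.
(* With [X = expR (e * L%:R / 2)] the final estimate is [B / (2 * X)], so [L] only has to give
   [B <= X]; this also yields [z <= g ^+ L], as [z <= B]. *)
pose B : R := 8 * z ^+ 5 / e ^+ 4.
have z0 : 0 < z by exact: lt_le_trans z1.
have B0 : 0 < B by rewrite divr_gt0 ?mulr_gt0 ?exprn_gt0.
have [L [L0 LB]] : exists L, (0 < L)%N /\ B <= e * L%:R / 2.
  exists (Num.trunc (2 / e * B)).+1; split => //.
  have H := truncnS_gt (2 / e * B).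
  rewrite ler_pdivlMr// -ler_pdivrMl// (le_trans _ (ltW H))//.
  by rewrite le_eqVlt; apply/orP; left; apply/eqP; ring.
exists L, (expR e).
have EB : B <= expR (e * L%:R / 2).
  by apply: (le_trans LB); have := expR_ge1Dx (e * L%:R / 2); lra.
have gL : expR e ^+ L = expR (e * L%:R / 2) ^+ 2.
  by rewrite -!expRM_natl; congr expR; field.
have zB : z <= B.
  rewrite /B ler_pdivlMr ?exprn_gt0//.
  have : z * e ^+ 4 <= z * 1 by rewrite ler_wpM2l ?(ltW z0)// exprn_ile1// ltW.
  have : z <= z ^+ 5 by rewrite -{1}(expr1 z) ler_weXn2l.
  by lra.
have B1 : 1 <= B by exact: le_trans zB.
split => //; first by rewrite -expR0 ler_expR ltW.
  rewrite gL; apply: (le_trans zB); apply: (le_trans EB).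
  by rewrite -{1}(expr1 (expR _)) ler_weXn2l// (le_trans B1).
set T := tau * L%:R.
have T0 : 0 <= T by rewrite mulr_ge0// ltW.
rewrite (_ : (fun b => _) = fun b : seq (dir d) => ((z ^+ 5 / expR e ^+ L)%:E *
    ((size b).+1%:R * (expR e ^+ 6) ^+ max_disp b)%:E)%E); last first.
  apply/funext => b; rewrite -EFinM /block_weight /column_weight exprM.
  by congr (_%:E); rewrite [RHS]mulrCA; congr (_ * _); rewrite mulrAC.
have zg0 : 0 <= z ^+ 5 / expR e ^+ L.
  by rewrite divr_ge0// exprn_ge0// ?expR_ge0// ltW.
have b0 (b : seq (dir d)) : (0 <= ((size b).+1%:R * (expR e ^+ 6) ^+ max_disp b)%:E)%E.
  by rewrite lee_fin mulr_ge0// !exprn_ge0// expR_ge0.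
rewrite EblockZ//.
have h1 : 1 <= expR e ^+ 6 by rewrite exprn_ege1// -expR0 ler_expR ltW.
have e2 : 0 < e ^+ 2 <= 1 by rewrite exprn_gt0//= exprn_ile1// ltW.
apply: (@le_trans _ _ ((z ^+ 5 / expR e ^+ L)%:E * (4 / (e ^+ 2) ^+ 2 *
   expR (T * ((1 + e ^+ 2) ^+ 2 * cosh_base (expR e ^+ 6) - 1)))%:E)%E).
  by apply: lee_wpmul2l => //; exact: Eblock_max_disp.
rewrite -EFinM lee_fin.
have ch : cosh_base (expR e ^+ 6) <= 1 + 72 * e ^+ 2.
  rewrite -expRM_natl (le_trans (cosh_base_expR _))//; last by nra.
  by apply/andP; split; lra.
have expo : T * ((1 + e ^+ 2) ^+ 2 * cosh_base (expR e ^+ 6) - 1) <= e * L%:R / 2.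
  (* For [D = e ^+ 2] the bound is that of [(1 + D) ^+ 2 * (1 + 72 * D) - 1] by [77 * D], where
     [72 = 2 * 6 ^ 2]; the linear coefficient is 74 and the smallness of [D] absorbs the rest. *)
  apply: (@le_trans _ _ (T * (77 * e ^+ 2))).
    rewrite ler_wpM2l//.
    have : e ^+ 2 <= 144^-1 by nra.
    move/andP: e2 => [e2 _]; move: (e ^+ 2) e2 ch => D D0 ch D1.
    have : (1 + D) ^+ 2 * cosh_base (expR e ^+ 6) <= (1 + D) ^+ 2 * (1 + 72 * D).
      by rewrite ler_wpM2l// sqr_ge0.
    nra.
  rewrite /T (_ : _ * (77 * _) = (154 * tau * e) * (e * L%:R / 2)); last by field.
  by rewrite ler_piMl// mulr_ge0// mulr_ge0// ltW.
apply: (@le_trans _ _ (z ^+ 5 / expR e ^+ L * (4 / (e ^+ 2) ^+ 2 * expR (e * L%:R / 2)))).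
  rewrite ler_wpM2l// ler_wpM2l ?ler_expR//.
  by rewrite divr_ge0// !exprn_ge0// ltW.
rewrite gL.
set X := expR _ in EB *.
have X0 : 0 < X by rewrite (lt_le_trans B0).
rewrite (_ : _ * _ = B / (2 * X)); last first.
  by rewrite /B; field; rewrite !gt_eqF.
by rewrite ler_pdivrMr ?mulr_gt0// mulKf.
Qed.

(** * Domination of a continuous-time walk by Poisson blocks *)

Lemma sigma_generated_bigcap (T : Type) (G : set (set T)) (A : nat -> set T) :
  (forall k, <<s G >> (A k)) -> <<s G >> (\bigcap_k A k).
Proof.
move=> GA M [[M0 MC MU] GM].
rewrite -(setCK (\bigcap_k A k)) -setTD setC_bigcap; apply: (MC).
by apply: (MU) => k; rewrite -setTD; apply: (MC); exact: (GA k M (conj (And3 M0 MC MU) GM)).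
Qed.

Section Countable.
Context (disp : measure_display) (T : measurableType disp).

Lemma bigcup_countType_measurable (V : countType) (A : V -> set T) :
  (forall v, measurable (A v)) -> measurable (\bigcup_v A v).
Proof.
move=> mA.
rewrite (_ : \bigcup_v A v =
    \bigcup_k (if @unpickle V k is Some v then A v else set0)).
  by apply: bigcup_measurable => k _; case: unpickle.
apply/seteqP; split => w [v _].
  by move=> Av; exists (pickle v) => //; rewrite pickleK.
by case E : unpickle => [u|//] Au; exists u.
Qed.

Lemma discrete_rv_preimage (V : countType) (X : T -> V) (B : set V) :
  discrete_rv X -> measurable (X @^-1` B).
Proof.
move=> mX.
rewrite (_ : X @^-1` B = \bigcup_v ([set w | B v] `&` X @^-1` [set v])).
  apply: bigcup_countType_measurable => v.
  have [Bv|Bv] := pselect (B v).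
    by rewrite (_ : [set w | B v] = setT) ?setTI//; apply/seteqP; split.
  by rewrite (_ : [set w | B v] = set0) ?set0I//; apply/seteqP; split.
by apply/seteqP; split => [w Bw|w [v _ [Bv]] /= ->] //; exists (X w).
Qed.

Lemma measurable_eindic (R : realType) (A : set T) :
  measurable A -> measurable_fun [set: T] (EFin \o (\1_A : T -> R)).
Proof. by move=> mA; apply/measurable_EFinP; exact: measurable_indic. Qed.

End Countable.

Section BlockDomination.
Context (ds : measure_display) (Om : measurableType ds) (R : realType).
Variables (P : probability Om R) (d : nat) (T : R).
Variables (N : R -> Om -> nat) (xi : nat -> Om -> lattice d.+2).
Hypothesis T0 : 0 <= T.
Hypothesis HN : poisson_process P N.
Hypothesis Hxi : srw_steps P xi.
Hypothesis HNxi : mutually_independent P (fun o : option nat =>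
   if o is Some n then sigma_rv (xi n) else sigma_process (@nonneg_times R) N).

Let u0 : dir d := (c0 d, true).

Definition counts (ns : seq nat) : set Om :=
  [set w | forall m, (m <= size ns)%N -> N (m%:R * T) w = sumn (take m ns)].

Definition steps (e : seq (dir d)) : set Om :=
  [set w | forall r, (r < size e)%N -> xi r w = step (nth u0 e r)].

Definition pweight (ns : seq nat) : R := \prod_(k <- ns) poisson_mass T k.

Let mT0 (m : nat) : 0 <= m%:R * T. Proof. by rewrite mulr_ge0. Qed.

Lemma sumn_take_rec ns m : (m < size ns)%N ->
  (sumn (take m.+1 ns) = sumn (take m ns) + nth 0%N ns m)%N.
Proof. by move=> ms; rewrite (take_nth 0%N ms) sumn_rcons. Qed.

Lemma l1norm_step (u : dir d) : l1norm (step u) = 1%N.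
Proof.
rewrite /l1norm (bigD1 u.1)//= stepE eqxx big1 => [|i iu].
  by case: u.2.
by rewrite stepE eq_sym (negbTE iu).
Qed.

Lemma P_xi r u : P [set w | xi r w = step u] = (step_prob R d)%:E.
Proof. by rewrite (steps_uniform Hxi) ?l1norm_step. Qed.

Lemma counts_sigma ns : sigma_process (@nonneg_times R) N (counts ns).
Proof.
rewrite (_ : counts ns = \bigcap_m (if (m <= size ns)%N then
   N (m%:R * T) @^-1` [set sumn (take m ns)] else setT)).
  apply: sigma_generated_bigcap => m; case: ifP => _.
    apply: sub_sigma_algebra; exists (m%:R * T) => /=; first exact: mT0.
    by exists [set sumn (take m ns)].
  by move=> M [[M0 MC MU] GM]; rewrite -(setD0 setT); exact: MC.
apply/seteqP; split => [w wc m _|w wc m ms].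
  by case: ifP => // ms; exact: wc.
by have := wc m I; rewrite ms.
Qed.

Lemma counts_measurable ns : measurable (counts ns).
Proof.
rewrite (_ : counts ns = \bigcap_m (if (m <= size ns)%N then
   N (m%:R * T) @^-1` [set sumn (take m ns)] else setT)).
  apply: bigcapT_measurable => m; case: ifP => _ //.
  by apply: (pp_measurable HN); exact: mT0.
apply/seteqP; split => [w wc m _|w wc m ms].
  by case: ifP => // ms; exact: wc.
by have := wc m I; rewrite ms.
Qed.

Lemma steps_measurable_event e : measurable (steps e).
Proof.
rewrite (_ : steps e = \bigcap_r (if (r < size e)%N then
   xi r @^-1` [set step (nth u0 e r)] else setT)).
  apply: bigcapT_measurable => m; case: ifP => _ //.
  exact: (steps_measurable Hxi).
apply/seteqP; split => [w wc m _|w wc m ms].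
  by case: ifP => // ms; exact: wc.
by have := wc m I; rewrite ms.
Qed.

Lemma P_counts ns : P (counts ns) = (pweight ns)%:E.
Proof.
pose t (i : nat) := i%:R * T.
have t0 : 0 <= t 0%N by exact: mT0.
have tm i : t i <= t i.+1 by rewrite ler_wpM2r// ler_nat.
pose A i : set Om := [set w | (N (t i.+1) w - N (t i) w)%N = nth 0%N ns i].
have -> : counts ns = \bigcap_(i in [set` iota 0 (size ns)]) A i.
  apply/seteqP; split => w.
    move=> wc i /=; rewrite mem_iota add0n => /andP[_ ins].
    by rewrite /A /= /t !wc ?(ltnW ins)// sumn_take_rec// addKn.
  move=> wA; elim => [|m IH] ms; first by rewrite mul0r take0 (pp_start HN).
  have := wA m; rewrite /= mem_iota add0n ms => /(_ isT) /= e.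
  have mono := pp_monotone HN w (mT0 m) (tm m).
  rewrite sumn_take_rec// -e -IH ?(ltnW ms)//.
  by rewrite subnKC.
rewrite (pp_independent_increments HN t0 tm) ?iota_uniq//; last first.
  by move=> i _; exists [set nth 0%N ns i].
rewrite /pweight (big_nth 0%N) -prodEFin /index_iota subn0; apply: eq_bigr => i _.
rewrite (pp_poisson_increments HN)//; last exact: mT0.
by rewrite /t -mulrBl -natr1 addrAC subrr add0r mul1r.
Qed.

Lemma P_event ns e : P (counts ns `&` steps e) = (pweight ns * step_prob R d ^+ size e)%:E.
Proof.
pose s : seq (option nat) := None :: map Some (iota 0 (size e)).
pose A (o : option nat) : set Om :=
  if o is Some r then [set w | xi r w = step (nth u0 e r)] else counts ns.
have -> : counts ns `&` steps e = \bigcap_(i in [set` s]) A i.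
  apply/seteqP; split => w.
    move=> [wc ws] [r|] /=; rewrite inE//=.
    by rewrite mem_map; [rewrite mem_iota => /andP[_] /ws|exact: Some_inj].
  move=> wA; split; first by apply: (wA None); rewrite /= inE eqxx.
  move=> r rs; apply: (wA (Some r)) => /=.
  by rewrite inE /= mem_map; [rewrite mem_iota|exact: Some_inj].
rewrite HNxi.
- rewrite big_cons big_map EFinM; congr (_ * _)%E; first exact: P_counts.
  transitivity (\prod_(i <- iota 0 (size e)) (step_prob R d)%:E)%E.
    by apply: eq_bigr => r _; exact: P_xi.
  by rewrite prodEFin big_const_seq count_predT size_iota iter_mulr_1.
- rewrite /= map_inj_uniq ?iota_uniq ?andbT; last exact: Some_inj.
  by apply/mapP => -[].
- move=> [r|] _ /=; last exact: counts_sigma.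
  by exists [set step (nth u0 e r)].
Qed.

Definition irregular : set Om := \bigcup_r \bigcap_(u : dir d) ~` [set w | xi r w = step u].

Lemma irregular_measurable : measurable irregular.
Proof.
apply: bigcupT_measurable => r.
rewrite -(setCK (\bigcap_u _)); apply: measurableC; rewrite setC_bigcap.
apply: bigcup_countType_measurable => u; rewrite setCK.
exact: (steps_measurable Hxi).
Qed.

Local Open Scope ereal_scope.

(** The unit steps are disjoint events whose probabilities already sum to 1, which leaves no mass
    for any other value of [xi r]. *)
Lemma P_irregular : P irregular = 0.
Proof.
have mx r u : measurable [set w | xi r w = step u] by exact: (steps_measurable Hxi).
have mB r : measurable (\bigcap_(u : dir d) ~` [set w | xi r w = step u]).
  rewrite -(setCK (\bigcap_u _)); apply: measurableC; rewrite setC_bigcap.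
  by apply: bigcup_countType_measurable => u; rewrite setCK.
have PB r : P (\bigcap_(u : dir d) ~` [set w | xi r w = step u]) = 0.
  set B := \bigcap_u _.
  have e1 : \int[P]_w ((\1_B w)%:E + \sum_(u : dir d) (\1_[set w | xi r w = step u] w)%:E)
     = P B + 1.
    rewrite ge0_integralD//=; last 3 first.
    - exact/measurable_eindic/mB.
    - by move=> w _; exact: sume_ge0.
    - by apply: emeasurable_sum => u; exact/measurable_eindic/mx.
    rewrite integral_indic//; last exact: mB.
    rewrite setIT ge0_integral_sum//=; last by move=> u; exact/measurable_eindic/mx.
    congr (_ + _); rewrite -(sum_step_prob R d); apply: eq_bigr => u _.
    by rewrite integral_indic// setIT; exact: P_xi.
  have e2 : \int[P]_w ((\1_B w)%:E + \sum_(u : dir d) (\1_[set w | xi r w = step u] w)%:E)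
     = 1.
    rewrite (_ : (fun w => _) = cst 1); first by rewrite integral_cst//= mul1e; exact: probability_setT.
    apply/funext => w /=; have [Bw|Bw] := pselect (B w).
      rewrite indicE mem_set// big1 ?adde0// => u _.
      by rewrite indicE memNset//; exact: Bw.
    rewrite indicE memNset// add0e.
    have [u Hu] : exists u : dir d, xi r w = step u.
      by apply: contrapT => H; apply: Bw => u _ /= Hu; apply: H; exists u.
    rewrite (bigD1 u)//= big1 => [|v vu]; first by rewrite indicE mem_set// adde0.
    rewrite indicE memNset//= Hu => uv; move/eqP: vu; apply.
    move: uv => /matrixP uv; apply/esym; move: (uv ord0 u.1) (uv ord0 v.1).
    rewrite !stepE !eqxx; case: u {Hu uv} => [i s]; case: v => [j s'] /=.
    by have [->|] := eqVneq i j; case: s; case: s'.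
  have PBf : P B \is a fin_num by rewrite fin_num_measure//; exact: mB.
  move: e1; rewrite e2 -(fineK PBf) -EFinD => -[h].
  by congr (_%:E); lra.
apply/eqP; rewrite eq_le measure_ge0 andbT.
apply: (le_trans (measure_sigma_subadditive P mB irregular_measurable (@subset_refl _ _))).
by rewrite eseries0// => r _ _; exact: PB.
Qed.

Section Dominated.
Variable Y : Om -> \bar R.
Hypothesis mY : measurable_fun [set: Om] Y.
Hypothesis Y0 : forall w, 0 <= Y w.
Hypothesis Yirr : forall w, irregular w -> Y w = 0.

Let J (A : set Om) := \int[P]_w (Y w * (\1_A w)%:E).

Let mYA A : measurable A -> measurable_fun [set: Om] (fun w => Y w * (\1_A w)%:E).
Proof. by move=> mA; apply: emeasurable_funM => //; exact: measurable_eindic. Qed.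

Let YA0 A w : 0 <= Y w * (\1_A w)%:E.
Proof. by rewrite mule_ge0. Qed.

Let mev ns e : measurable (counts ns `&` steps e).
Proof. by apply: measurableI; [exact: counts_measurable|exact: steps_measurable_event]. Qed.

Let J_rcons_step ns e :
  J (counts ns `&` steps e) <= \sum_(u : dir d) J (counts ns `&` steps (rcons e u)).
Proof.
rewrite -ge0_integral_sum//; last by move=> u; exact: mYA.
apply: ge0_le_integral => //; first exact: mYA.
  by apply: emeasurable_sum => u; exact: mYA.
move=> w _; have [[wc ws]|nw] := pselect ((counts ns `&` steps e) w); last first.
  by rewrite {1}indicE memNset// mule0 sume_ge0.
have [wi|wi] := pselect (irregular w); first by rewrite Yirr// mul0e sume_ge0// => u _; rewrite mul0e.
have [u Hu] : exists u : dir d, xi (size e) w = step u.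
  by apply: contrapT => H; apply: wi; exists (size e) => // u _ /= Hu; apply: H; exists u.
rewrite (bigD1 u)//= -[leLHS]adde0 leeD//; last by rewrite sume_ge0.
rewrite !indicE !mem_set//; split => // r; rewrite size_rcons ltnS leq_eqVlt.
by rewrite nth_rcons => /orP[/eqP->|re]; rewrite ?ltnn ?eqxx// re; exact: ws.
Qed.

Let J_rcons_count ns e :
  J (counts ns `&` steps e) <= \sum_(k <oo) J (counts (rcons ns k) `&` steps e).
Proof.
rewrite -integral_nneseries//; last by move=> u; exact: mYA.
apply: ge0_le_integral => //; first exact: mYA.
  by apply: ge0_emeasurable_sum => // u _; exact: mYA.
move=> w _; have [[wc ws]|nw] := pselect ((counts ns `&` steps e) w); last first.
  by rewrite {1}indicE memNset// mule0 nneseries_ge0.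
pose k := (N ((size ns).+1%:R * T) w - N ((size ns)%:R * T) w)%N.
apply: (@le_trans _ _ (Y w * (\1_(counts (rcons ns k) `&` steps e) w)%:E)); last first.
  by apply: (le_trans _ (nneseries_lim_ge k.+1 _)) => //; rewrite big_nat_recr//= leeDr// sume_ge0.
rewrite !indicE !mem_set//; split => // m; rewrite size_rcons leq_eqVlt ltnS.
move=> /orP[/eqP->|ms]; last first.
  by rewrite -cats1 takel_cat; [exact: wc|exact: ms].
rewrite take_oversize ?size_rcons// sumn_rcons.
have := wc _ (leqnn _); rewrite take_size => <-; rewrite /k subnKC//.
by apply: (pp_monotone HN); rewrite ?mT0// ler_wpM2r// ler_nat.
Qed.

Let pw0 ns : (0 <= pweight ns)%R.
Proof. by apply: prodr_ge0 => i _; exact: poisson_mass_ge0. Qed.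

Let avg_domination k ns e (F : seq (dir d) -> \bar R) :
  (forall t, 0 <= F t) ->
  (forall t, size t = k -> J (counts ns `&` steps (e ++ t)) <=
     (pweight ns * step_prob R d ^+ (size e + k))%:E * F t) ->
  J (counts ns `&` steps e) <= (pweight ns * step_prob R d ^+ size e)%:E * avg k F.
Proof.
elim: k e F => [|k IH] e F F0 HF.
  by have := HF [::] erefl; rewrite cats0 addn0.
apply: (le_trans (J_rcons_step _ _)).
rewrite /= ge0_sume_distrr; last first.
  by move=> u _; rewrite mule_ge0 ?lee_fin ?step_prob_ge0 ?avg_ge0.
apply: lee_sum => u _.
rewrite muleA -EFinM -mulrA -exprSr -(size_rcons e u).
apply: IH => // t st; rewrite cat_rcons size_rcons addSnnS.
by apply: HF; rewrite /= st.
Qed.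

(** Blocks are revealed one at a time. The event that the blocks [p] have occurred is covered by its
    refinements, first by the next number of jumps, then by each new step; once all blocks are
    revealed, [Y] is at most a constant on an event whose probability is [P_event]. *)
Let block_domination_rec M p (G : seq (seq (dir d)) -> R) :
  (forall bs, 0 <= G bs)%R ->
  (forall bs, size bs = M -> forall w,
     (counts (map size (p ++ bs)) `&` steps (flatten (p ++ bs))) w -> Y w <= (G bs)%:E) ->
  J (counts (map size p) `&` steps (flatten p)) <=
  (pweight (map size p) * step_prob R d ^+ size (flatten p))%:E * Eblocks T M (fun bs => (G bs)%:E).
Proof.
move=> G0; elim: M p G G0 => [|M IH] p G G0 HG.
  rewrite -P_event /= muleC.
  have -> : P (counts (map size p) `&` steps (flatten p)) =
      \int[P]_w (\1_(counts (map size p) `&` steps (flatten p)) w)%:E.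
    by rewrite integral_indic// setIT.
  rewrite -ge0_integralZl//; [|exact: measurable_eindic|by rewrite lee_fin].
  apply: ge0_le_integral => //; first exact: mYA.
    by apply: emeasurable_funM => //; exact: measurable_eindic.
  move=> w _; rewrite indicE; have [wE|wE] := boolP (w \in _); last by rewrite !mule0.
  by rewrite !mule1; apply: (HG [::]) => //; rewrite cats0; exact: set_mem.
apply: (le_trans (J_rcons_count _ _)).
rewrite /= /Eblock -nneseriesZl; last first.
  move=> k _; rewrite mule_ge0 ?lee_fin ?poisson_mass_ge0//.
  by apply: avg_ge0 => b; apply: Eblocks_ge0 => // bs; rewrite lee_fin.
apply: lee_nneseries => [k _ _|k _]; first exact: integral_ge0.
rewrite muleA -EFinM mulrAC.
have -> : (pweight (map size p) * poisson_mass T k = pweight (rcons (map size p) k))%R.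
  by rewrite /pweight big_rcons.
apply: avg_domination => [t|t st]; first by apply: Eblocks_ge0 => // bs; rewrite lee_fin.
have := IH (rcons p t) (fun bs => G (t :: bs)).
rewrite map_rcons flatten_rcons size_cat st; apply => // bs sbs w.
by rewrite cat_rcons => Hw; apply: HG => //=; rewrite sbs.
Qed.

Lemma regular_block_domination M (G : seq (seq (dir d)) -> R) :
  (forall bs, 0 <= G bs)%R ->
  (forall bs, size bs = M -> forall w,
     (counts (map size bs) `&` steps (flatten bs)) w -> Y w <= (G bs)%:E) ->
  \int[P]_w Y w <= Eblocks T M (fun bs => (G bs)%:E).
Proof.
move=> G0 HG; have := @block_domination_rec M [::] G G0 HG.
rewrite /pweight /= big_nil mul1r expr0 mul1e; apply: le_trans.
apply: ge0_le_integral => //; first exact: mYA.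
move=> w _; rewrite indicE mem_set ?mule1//; split => // m.
by rewrite leqn0 => /eqP ->; rewrite mul0r (pp_start HN).
Qed.

End Dominated.

Lemma block_domination (Y : Om -> \bar R) M (G : seq (seq (dir d)) -> R) :
  measurable_fun [set: Om] Y -> (forall w, 0 <= Y w) ->
  (forall bs, 0 <= G bs)%R ->
  (forall bs, size bs = M -> forall w,
     (counts (map size bs) `&` steps (flatten bs)) w -> Y w <= (G bs)%:E) ->
  \int[P]_w Y w <= Eblocks T M (fun bs => (G bs)%:E).
Proof.
move=> mY Y0 G0 HG.
have mC : measurable (~` irregular) by apply: measurableC; exact: irregular_measurable.
have mY' : measurable_fun [set: Om] (fun w => Y w * (\1_(~` irregular) w)%:E).
  by apply: emeasurable_funM => //; exact: measurable_eindic.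
rewrite (@ae_eq_integral _ _ _ P _ (fun w => Y w * (\1_(~` irregular) w)%:E))//.
  apply: regular_block_domination => //.
  - by move=> w; rewrite mule_ge0.
  - by move=> w wi; rewrite indicE memNset ?mule0//; apply.
  - move=> bs sbs w wb; apply: le_trans (HG _ sbs _ wb).
    by rewrite -[leRHS]mule1; apply: lee_wpmul2l => //; rewrite lee_fin indicE; case: (_ \in _).
exists irregular; split; [exact: irregular_measurable|exact: P_irregular|].
move=> w /= nw; apply: contrapT => wi; apply: nw => _.
by rewrite indicE mem_set ?mule1.
Qed.

End BlockDomination.

(** * Expectations of products of independent variables *)

Section IndependentProducts.
Context (ds : measure_display) (Om : measurableType ds) (R : realType).
Variable P : probability Om R.
Local Open Scope ereal_scope.

(** Independence is postulated for events. It extends to this class by expanding each factor into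
    indicators, and the class contains the powers of integer-valued counts used below. *)
Record countably_simple (F : set (set Om)) (f : Om -> R) : Prop := CountablySimple {
  cs_ge0 : forall w, (0 <= f w)%R;
  cs_fin : \int[P]_w (f w)%:E < +oo;
  cs_rep : exists (c : nat -> R) (A : nat -> set Om),
    [/\ forall k, (0 <= c k)%R, forall k, measurable (A k), forall k, F (A k) &
        forall w, (f w)%:E = \sum_(k <oo) (c k * \1_(A k) w)%:E] }.

Lemma cs_measurable F f : countably_simple F f ->
  measurable_fun [set: Om] (fun w => (f w)%:E).
Proof.
move=> [_ _ [c [A [c0 mA _ fE]]]].
rewrite (_ : (fun w => _) = fun w => \sum_(k <oo) (c k * \1_(A k) w)%:E); last exact/funext.
apply: ge0_emeasurable_sum => [k w _ _|k _].
  by rewrite lee_fin mulr_ge0.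
apply/measurable_EFinP; apply: measurable_funM => //; exact: measurable_indic.
Qed.

Lemma cs_prod_measurable (I : Type) (s : seq I) (F : I -> set (set Om)) (f : I -> Om -> R) :
  (forall i, countably_simple (F i) (f i)) ->
  measurable_fun [set: Om] (fun w => (\prod_(i <- s) f i w)%:E).
Proof.
move=> cf; elim: s => [|i s IH].
  rewrite (_ : (fun w => _) = cst 1); first exact: measurable_cst.
  by apply/funext => w; rewrite big_nil.
rewrite (_ : (fun w => _) = fun w => (f i w)%:E * (\prod_(i <- s) f i w)%:E); last first.
  by apply/funext => w; rewrite big_cons EFinM.
apply: emeasurable_funM => //; exact: cs_measurable (cf i).
Qed.

Variables (I : eqType) (F : I -> set (set Om)) (f : I -> Om -> R).
Hypothesis HF : mutually_independent P F.
Hypothesis cf : forall i, countably_simple (F i) (f i).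

(** The mixed form is what the induction needs: expanding the head factor into indicators moves its
    index from the functions [s] to the events [r]. *)
Lemma expectation_prod_event (s r : seq I) (B : I -> set Om) :
  uniq (s ++ r) -> (forall i, i \in r -> F i (B i) /\ measurable (B i)) ->
  \int[P]_w ((\prod_(i <- s) f i w) * \1_(\bigcap_(i in [set` r]) B i) w)%:E =
  \prod_(i <- s) (\int[P]_w (f i w)%:E) * \prod_(i <- r) P (B i).
Proof.
have mcap (r' : seq I) (B' : I -> set Om) :
    (forall i, i \in r' -> F i (B' i) /\ measurable (B' i)) ->
    measurable (\bigcap_(i in [set` r']) B' i).
  by move=> H; apply: fin_bigcap_measurable => // i /H[].
have pf0 s' w : (0 <= \prod_(i <- s') f i w)%R.
  by apply: prodr_ge0 => i _; exact: cs_ge0 (cf i) w.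
elim: s r B => [|i s IH] r B us HB.
  under eq_integral => w _ do rewrite big_nil mul1r.
  rewrite big_nil mul1e integral_indic//; last exact: mcap.
  by rewrite setIT; apply: HF => // i /HB[].
have [_ _ [c [A [c0 mA FA fE]]]] := cf i.
have finQ : (\prod_(i0 <- s) \int[P]_w (f i0 w)%:E) \is a fin_num.
  elim/big_ind: _ => // [x y|j _]; first exact: fin_numM.
  rewrite ge0_fin_numE; first exact: cs_fin (cf j).
  by apply: integral_ge0 => w _; rewrite lee_fin; exact: cs_ge0 (cf j) w.
have finr : (\prod_(j <- r) P (B j)) \is a fin_num.
  rewrite big_seq; elim/big_ind: _ => // [x y|j jr]; first exact: fin_numM.
  by rewrite fin_num_measure//; exact: (HB j jr).2.
pose B' k j := if j == i then A k else B j.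
have inr : i \notin r.
  by move: us; rewrite /= mem_cat negb_or => /andP[/andP[_]].
have us' : uniq (s ++ i :: r).
  move: us; rewrite /= mem_cat negb_or cat_uniq => /andP[/andP[is_ ir]] /and3P[us hs ur].
  by rewrite cat_uniq us /= ir ur negb_or is_ hs.
have HB' k j : j \in i :: r -> F j (B' k j) /\ measurable (B' k j).
  by rewrite inE /B'; have [->|_] := eqVneq j i => //= /HB.
have capE k : \bigcap_(j in [set` i :: r]) B' k j = A k `&` \bigcap_(j in [set` r]) B j.
  apply/seteqP; split => w.
    move=> H; split; first by have := H i; rewrite /B' eqxx; apply; rewrite /= mem_head.
    move=> j /= jr; have := H j; rewrite /B'; have [ji|_] := eqVneq j i.
      by move: inr; rewrite -ji jr.
    by apply; rewrite /= inE jr orbT.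
  move=> [Aw Bw] j /=; rewrite inE /B'; have [//|_ /= jr] := eqVneq j i.
  exact: Bw.
have mS := cs_prod_measurable s cf.
transitivity (\sum_(k <oo) (c k)%:E * \int[P]_w
    ((\prod_(i <- s) f i w) * \1_(\bigcap_(j in [set` i :: r]) B' k j) w)%:E).
  rewrite (_ : (fun w => _) = fun w => \sum_(k <oo) ((c k)%:E *
     ((\prod_(i <- s) f i w) * \1_(\bigcap_(j in [set` i :: r]) B' k j) w)%:E)); last first.
    apply/funext => w.
    rewrite big_cons -mulrA mulrC EFinM fE -nneseriesZl; last first.
      by move=> k _; rewrite lee_fin mulr_ge0.
    apply: eq_eseriesr => k _; rewrite -!EFinM capE indicI /=; congr (_%:E); ring.
  have mk k : measurable_fun [set: Om] (fun w =>
     ((\prod_(i <- s) f i w) * \1_(\bigcap_(j in [set` i :: r]) B' k j) w)%:E).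
    rewrite (_ : (fun w => _) = (fun w => (\prod_(i <- s) f i w)%:E *
       (EFin \o \1_(\bigcap_(j in [set` i :: r]) B' k j)) w)); last first.
      by apply/funext => w; rewrite EFinM.
    apply: emeasurable_funM => //; apply: measurable_eindic; apply: mcap; exact: HB'.
  have nn k w : 0 <= ((\prod_(i <- s) f i w) * \1_(\bigcap_(j in [set` i :: r]) B' k j) w)%:E.
    by rewrite lee_fin mulr_ge0.
  rewrite integral_nneseries//; last 2 first.
  - by move=> k; apply: emeasurable_funM.
  - by move=> k w _; rewrite mule_ge0 ?nn ?lee_fin.
  apply: eq_eseriesr => k _; rewrite ge0_integralZl//; by rewrite lee_fin.
rewrite (_ : \sum_(k <oo) _ = \sum_(k <oo) ((fine (\prod_(i <- s) \int[P]_w (f i w)%:E * \prod_(i <- r) P (B i)))%:E * ((c k)%:E * P (A k)))).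
  rewrite nneseriesZl; last by move=> k _; rewrite mule_ge0 ?lee_fin.
  rewrite fineK; last first.
    by rewrite fin_numM.
  rewrite big_cons muleC -muleA; congr (_ * _).
  rewrite (_ : (fun w => _) = fun w => \sum_(k <oo) ((c k)%:E * (\1_(A k) w)%:E)); last first.
    by apply/funext => w; rewrite fE; apply: eq_eseriesr => k _; rewrite EFinM.
  rewrite integral_nneseries//; last 2 first.
  - by move=> k; apply: emeasurable_funM => //; exact: measurable_eindic.
  - by move=> k w _; rewrite mule_ge0 ?lee_fin.
  apply: eq_eseriesr => k _; rewrite ge0_integralZl//; last 2 first.
  - exact: measurable_eindic.
  - by rewrite lee_fin.
  by rewrite integral_indic// setIT.
apply: eq_eseriesr => k _; rewrite (IH _ _ us' (HB' k)).
rewrite fineK; last first.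
  by rewrite fin_numM.
rewrite big_cons {1}/B' eqxx.
have -> : \prod_(j <- r) P (B' k j) = \prod_(j <- r) P (B j).
  rewrite !big_seq; apply: eq_bigr => j jr; rewrite /B'.
  by case: eqP jr inr => // -> ->.
by rewrite muleCA -[RHS]muleA; congr (_ * _); rewrite muleA muleC.
Qed.

Lemma expectation_prod (s : seq I) : uniq s ->
  \int[P]_w (\prod_(i <- s) f i w)%:E = \prod_(i <- s) (\int[P]_w (f i w)%:E).
Proof.
move=> us; have := @expectation_prod_event s [::] (fun=> setT).
rewrite cats0 big_nil mule1 => <- //; apply: eq_integral => w _.
by rewrite indicE mem_set ?mulr1.
Qed.

End IndependentProducts.

(** * Touched sites *)

Lemma sigma_count (T X : Type) (S : set (set T)) (E : X -> set T) :
  sigma_algebra [set: T] S -> (forall a, S (E a)) ->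
  forall A k, S [set w | count (fun a => `[<E a w>]) A = k].
Proof.
move=> [S0 SC SU] SE.
have SC' B : S B -> S (~` B) by move=> /SC; rewrite setTD.
have SU2 B C : S B -> S C -> S (B `|` C).
  move=> SB SC2; rewrite -bigcup2E; apply: SU => -[|[|k]] //=.
have SI2 B C : S B -> S C -> S (B `&` C).
  by move=> SB SC2; rewrite -(setCK (B `&` C)) setCI; apply/SC'/SU2; exact: SC'.
elim=> [|a A IH] k /=.
  have [->|k0] := eqVneq k 0%N.
    rewrite (_ : [set w | _] = ~` set0); first exact: SC'.
    by apply/seteqP; split => [w _ []|w _].
  rewrite (_ : [set w | _] = set0)//; apply/seteqP; split => // w /= /esym/eqP.
  by rewrite (negbTE k0).
rewrite (_ : [set w | _] =
   (E a `&` (if k is k'.+1 then [set w | count (fun a => `[<E a w>]) A = k'] else set0)) `|`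
   (~` E a `&` [set w | count (fun a => `[<E a w>]) A = k])).
  apply: SU2; apply: SI2 => //; last exact: SC'.
  by case: k => // k; exact: IH.
apply/seteqP; split => w /=.
  have [Ew|Ew] := pselect (E a w).
    by rewrite asboolT//= add1n; case: k => // k [<-]; left.
  by rewrite asboolF//= add0n => <-; right.
move=> [[Ew]|[Ew <-]]; last by rewrite asboolF.
by case: k => //= k ->; rewrite asboolT.
Qed.

Section WalkTouches.
Context (ds : measure_display) (Om : measurableType ds) (R : realType).
Variables (P : probability Om R) (d L : nat) (T : R).
Hypothesis T0 : 0 <= T.
Variable zeta : R -> Om -> lattice d.+2.
Hypothesis Hz : ct_srw P zeta.

(* Rational times make this a countable union; by right continuity nothing is lost. *)
Definition touch (x : lattice d.+2) (a : nat * nat) : set Om :=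
  [set w | exists q : rat, [/\ a.1%:R * T <= ratr q, ratr q < a.1.+1%:R * T &
     box L a (x + zeta (ratr q) w)]].

Definition touches (A : seq (nat * nat)) (x : lattice d.+2) (w : Om) : nat :=
  count (fun a => `[<touch x a w>]) A.

Lemma touch_sigma x a : sigma_process (@nonneg_times R) zeta (touch x a).
Proof.
have [S0 SC SU] := smallest_sigma_algebra setT
   (\bigcup_(t in @nonneg_times R) sigma_rv (zeta t)).
rewrite (_ : touch x a = \bigcup_k (if @unpickle rat k is Some q then
    if (a.1%:R * T <= ratr q) && (ratr q < a.1.+1%:R * T)
    then zeta (ratr q) @^-1` [set v | box L a (x + v)] else set0 else set0)).
  apply: SU => k; case: unpickle => [q|]; last exact: S0.
  case: ifP => [/andP[qT _]|_]; last exact: S0.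
  apply: sub_sigma_algebra; exists (ratr q).
    by rewrite /nonneg_times /= (le_trans _ qT)// mulr_ge0.
  by exists [set v | box L a (x + v)].
apply/seteqP; split => w.
  move=> [q [q1 q2 q3]]; exists (pickle q); first exact: I.
  by rewrite pickleK q1 q2; exact: q3.
move=> [k _]; case: unpickle => [q|//]; case: ifP => [/andP[q1 q2] q3|//].
by exists q.
Qed.

Lemma walk_discrete t : 0 <= t -> discrete_rv (zeta t).
Proof.
move=> t0; have [N [xi [HN Hxi _ zE]]] := Hz.
have mS n : discrete_rv (fun w => \sum_(r < n) xi r w).
  elim: n => [|n IH] v.
    rewrite (_ : _ @^-1` _ = [set w | 0 = v]); last first.
      by apply/seteqP; split => w /=; rewrite big_ord0.
    have [<-|nv] := pselect (0 = v).
      by rewrite (_ : [set _ | _] = setT)//; apply/seteqP; split.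
    by rewrite (_ : [set _ | _] = set0)//; apply/seteqP; split.
  rewrite (_ : _ @^-1` _ = \bigcup_(u : lattice d.+2)
     ((fun w => \sum_(r < n) xi r w) @^-1` [set u] `&` xi n @^-1` [set v - u])).
    apply: bigcup_countType_measurable => u; apply: measurableI; first exact: IH.
    exact: (steps_measurable Hxi).
  apply/seteqP; split => w /=.
    by move=> <-; exists (\sum_(r < n) xi r w) => //=; rewrite big_ord_recr/= addrC addrK.
  by move=> [u _ /= [eu ev]]; rewrite big_ord_recr/= eu ev addrC subrK.
move=> v.
rewrite (_ : _ @^-1` _ = \bigcup_n
    (N t @^-1` [set n] `&` (fun w => \sum_(r < n) xi r w) @^-1` [set v])).
  apply: bigcupT_measurable => n; apply: measurableI; first exact: (pp_measurable HN).
  exact: mS.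
apply/seteqP; split => w /=.
  by rewrite zE// => <-; exists (N t w).
by move=> [n _ /= [nE <-]]; rewrite zE// nE.
Qed.

Lemma sigma_walk_measurable : sigma_process (@nonneg_times R) zeta `<=` measurable.
Proof.
apply: smallest_sub; first exact: sigma_algebra_measurable.
move=> A [t t0] [B _ <-]; apply: discrete_rv_preimage; exact: walk_discrete.
Qed.

Lemma touches_sigma A x k :
  sigma_process (@nonneg_times R) zeta [set w | touches A x w = k].
Proof.
apply: sigma_count; first exact: smallest_sigma_algebra.
by move=> a; exact: touch_sigma.
Qed.

Variables z g : R.
Hypothesis L0 : (0 < L)%N.
Hypothesis z1 : 1 <= z.
Hypothesis g1 : 1 <= g.
Hypothesis zg : z <= g ^+ L.
Hypothesis half : (Eblock T (fun b => (@block_weight R d L z g b)%:E) <= (2^-1)%:E)%E.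

Definition columns (A : seq (nat * nat)) : nat := (\max_(a <- A) a.1).+1%N.

Lemma touches_repr A x w : (z ^+ touches A x w)%:E =
  (\sum_(k <oo) (z ^+ k * \1_[set w | touches A x w = k] w)%:E)%E.
Proof.
set k0 := touches A x w.
have z0 k : 0 <= z ^+ k by rewrite exprn_ge0// (le_trans ler01).
rewrite (@nneseriesD1 _ _ k0)//; last by move=> k _; rewrite lee_fin mulr_ge0.
rewrite indicE mem_set// mulr1 eseries0 ?adde0// => k _ /= kk0.
by rewrite indicE memNset ?mulr0// => /= e; move: kk0; rewrite -e eqxx.
Qed.

Lemma touches_measurable A x :
  measurable_fun [set: Om] (fun w => (z ^+ touches A x w)%:E).
Proof.
rewrite (_ : (fun w => _) = fun w =>
  (\sum_(k <oo) (z ^+ k * \1_[set w | touches A x w = k] w)%:E)%E); last first.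
  by apply/funext => w; rewrite touches_repr.
have z0 k : 0 <= z ^+ k by rewrite exprn_ge0// (le_trans ler01).
apply: ge0_emeasurable_sum => [k w _ _|k _]; first by rewrite lee_fin mulr_ge0.
apply/measurable_EFinP; apply: measurable_funM => //; apply: measurable_indic.
by apply: sigma_walk_measurable; exact: touches_sigma.
Qed.

(** Monotonicity of [N] places the number of jumps at a time of block [a.1] between its values at
    the two ends, so the walk is then at the end of some prefix of that block. *)
Lemma touch_hit (N : R -> Om -> nat) (xi : nat -> Om -> lattice d.+2) x a bs w :
  poisson_process P N ->
  (forall t w, 0 <= t -> zeta t w = \sum_(n < N t w) xi n w) ->
  (a.1 < size bs)%N ->
  counts T N (map size bs) w -> steps xi (flatten bs) w -> touch x a w -> hit L x bs a.
Proof.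
move=> HN zE aM wc ws [q [q1 q2 qb]].
have aT0 : 0 <= a.1%:R * T by rewrite mulr_ge0.
have q0 : 0 <= ratr q :> R by exact: le_trans q1.
set t : R := ratr q in q1 q2 qb q0.
set b := nth [::] bs a.1.
have sz k : sumn (take k (map size bs)) = size (flatten (take k bs)).
  by rewrite size_flatten /shape map_take.
have n1 : N (a.1%:R * T) w = size (flatten (take a.1 bs)).
  by rewrite wc ?size_map ?(ltnW aM)// sz.
have n2 : N (a.1.+1%:R * T) w = (size (flatten (take a.1 bs)) + size b)%N.
  by rewrite wc ?size_map// sz flatten_takeS size_cat.
have m1 := pp_monotone HN w aT0 q1.
have m2 := pp_monotone HN w q0 (ltW q2).
rewrite n1 in m1; rewrite n2 in m2.
pose l := (N t w - size (flatten (take a.1 bs)))%N.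
have lb : (l < (size b).+1)%N by rewrite ltnS leq_subLR.
have Nt : N t w = (size (flatten (take a.1 bs)) + l)%N by rewrite /l subnKC.
have fl : flatten bs = flatten (take a.1 bs) ++ b ++ flatten (drop a.1.+1 bs).
  rewrite catA -flatten_takeS -flatten_cat; congr flatten.
  by rewrite cat_take_drop.
have zt : zeta t w = disp (flatten (take a.1 bs)) + disp (take l b).
  rewrite zE// -disp_cat.
  have -> : flatten (take a.1 bs) ++ take l b = take (N t w) (flatten bs).
    rewrite fl Nt take_cat ltnNge leq_addr/= addKn take_cat.
    case: ltnP => // lb'; have -> : l = size b by apply/eqP; rewrite eqn_leq lb' -ltnS lb.
    by rewrite subnn take0 cats0 take_size.
  have Ns : (N t w <= size (flatten bs))%N 
    by rewrite fl !size_cat Nt leq_add2l (leq_trans _ (leq_addr _ _)).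
  rewrite /disp (big_nth (c0 d, true)) size_takel// big_mkord; apply: eq_bigr => r _.
  by rewrite ws ?nth_take//; exact: leq_trans Ns.
rewrite /hit aM /=; apply/existsP; exists (Ordinal lb) => /=.
by move: qb; rewrite zt addrA.
Qed.

Lemma expectation_touches A x :
  (\int[P]_w (z ^+ touches A x w)%:E <= 1 + excess L T z (columns A) A x)%E.
Proof.
have [N [xi [HN Hxi Hind zE]]] := Hz.
have zz n : 1 <= z ^+ n by rewrite exprn_ege1.
apply: (@le_trans _ _ (Eblocks T (columns A) (fun bs => (z ^+ count (hit L x bs) A)%:E))).
  apply: (block_domination T0 HN Hxi Hind).
  - exact: touches_measurable.
  - by move=> w; rewrite lee_fin (le_trans ler01).
  - by move=> bs; rewrite (le_trans ler01).
  move=> bs sbs w [wc ws]; rewrite lee_fin ler_weXn2l// /touches.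
  rewrite -(eq_in_count (a1 := fun a => (a \in A) && `[<touch x a w>])); last by move=> a /= ->.
  apply: sub_count => a /= /andP[aA /asboolP wt].
  rewrite (touch_hit HN zE _ wc ws wt)// sbs /columns ltnS.
  exact: (@bigop.leq_bigmax_seq _ A xpredT (fun a => a.1) a).
rewrite /excess -[X in (X + _)%E](@Eblocks_cst R d T T0 (columns A) 1)// -EblocksD//; last first.
  by move=> bs; rewrite lee_fin subr_ge0.
apply: le_Eblocks => // bs; first by rewrite lee_fin (le_trans ler01).
by rewrite -EFinD lee_fin addrC subrK.
Qed.

Lemma excess_fin A (x : lattice d.+2) : uniq A -> excess L T z (columns A) A x \is a fin_num.
Proof.
move=> uA; rewrite ge0_fin_numE; last exact: excess_ge0.
have := sum_excess L0 T0 z1 g1 zg half (columns A) (K := [:: x]) isT uA.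
rewrite big_seq1 => /le_lt_trans; apply.
by rewrite -EFinM ltry.
Qed.

Lemma touches_countably_simple A x : uniq A ->
  countably_simple P (sigma_process (@nonneg_times R) zeta) (fun w => z ^+ touches A x w).
Proof.
move=> uA; have z0 k : 0 <= z ^+ k by rewrite exprn_ge0// (le_trans ler01).
split => //.
  rewrite (le_lt_trans (expectation_touches A x))//.
  by rewrite lte_add_pinfty ?ltry//; rewrite -ge0_fin_numE ?excess_fin// excess_ge0.
exists (fun k => z ^+ k), (fun k => [set w | touches A x w = k]); split => //.
- by move=> k; apply: sigma_walk_measurable; exact: touches_sigma.
- by move=> k; exact: touches_sigma.
- exact: touches_repr.
Qed.

End WalkTouches.

(** * Occupation numbers *)

Section CountingNat.
Import finmap.

(** Eventual constancy of counts over initial segments makes occupation numbers measurable and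
    comparable with counts over the first [n] labels. *)
Lemma counting_nat (R : realType) (X : set nat) k : counting X = k%:R%:E :> \bar R <->
  exists n, forall m, (n <= m)%N -> count (fun j => `[<X j>]) (iota 0 m) = k.
Proof.
have fincase n : (forall j, X j -> (j < n)%N) -> finite_set X /\
    forall m, (n <= m)%N -> count (fun j => `[<X j>]) (iota 0 m) = size (fset_set X).
  move=> Xn; have fX : finite_set X.
    by apply: (@sub_finite_set _ _ `I_n) => // j /Xn.
  split => // m nm; rewrite -size_filter; apply/perm_size/uniq_perm.
  - by rewrite filter_uniq// iota_uniq.
  - exact: fset_uniq.
  move=> j; rewrite mem_filter mem_iota add0n in_fset_set//=.
  apply/andP/idP => [[/asboolP Xj _]|/set_mem Xj]; first exact: mem_set.
  by rewrite asboolT//; split => //; exact: leq_trans (Xn _ Xj) nm.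
rewrite /counting; split.
  case: asboolP => // fX [] /eqP; rewrite eqr_nat => /eqP <-.
  have [n Xn] : exists n, forall j, X j -> (j < n)%N.
    have [s Xs] := fX; exists (\max_(j <- fset_set X) j).+1 => j Xj.
    by rewrite ltnS; apply: (@bigop.leq_bigmax_seq _ _ xpredT id) => //; rewrite in_fset_set// mem_set.
  by exists n; exact: (fincase n Xn).2.
move=> [n Hn].
have Xn j : X j -> (j < n)%N.
  move=> Xj; rewrite ltnNge; apply/negP => nj.
  have := Hn j.+1 (leqW nj); rewrite -(Hn j nj) -(addn1 j) iotaD count_cat /= add0n.
  by rewrite asboolT//= addn0 => /eqP; rewrite -{2}(addn0 (count _ _)) eqn_add2l.
have [fX H] := fincase n Xn.
by rewrite asboolT// -(H n)// Hn.
Qed.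

End CountingNat.

Section Occupation.
Context (ds : measure_display) (Om : measurableType ds) (R : realType).
Variables (P : probability Om R) (d : nat) (lambda : R).
Hypothesis l0 : 0 <= lambda.
Variable eta0 : nat -> Om -> option (lattice d).
Hypothesis Heta : poisson_points P lambda eta0.

Definition label_count (n : nat) (x : lattice d) (w : Om) : nat :=
  count (fun j => eta0 j w == Some x) (iota 0 n).

Lemma label_count_le n m x w : (n <= m)%N -> (label_count n x w <= label_count m x w)%N.
Proof.
by move=> nm; rewrite /label_count -(subnKC nm) iotaD count_cat leq_addr.
Qed.

Lemma occupation_natP x w k : occupation R eta0 x w = k%:R%:E <->
  exists n, forall m, (n <= m)%N -> label_count m x w = k.
Proof.
rewrite /occupation counting_nat.
have E m : count (fun j => `[<[set j | eta0 j w = Some x] j>]) (iota 0 m) = label_count m x w.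
  by apply: eq_count => j /=; apply/asboolP/eqP.
by split => -[n H]; exists n => m nm; have := H m nm; rewrite E.
Qed.

Lemma label_event_measurable n x k : measurable [set w | label_count n x w = k].
Proof.
rewrite (_ : [set w | _] = [set w | count (fun j => `[<eta0 j w = Some x>]) (iota 0 n) = k]).
  apply: (@sigma_count _ _ _ (fun j => [set w | eta0 j w = Some x])).
    exact: sigma_algebra_measurable.
  by move=> j; exact: (pts_measurable Heta).
apply/seteqP; split => w /= <-; apply: eq_count => j; first by apply/asboolP/eqP.
by apply/eqP/asboolP.
Qed.

Lemma occupation_event_measurable x k :
  measurable [set w | occupation R eta0 x w = k%:R%:E].
Proof.
rewrite (_ : [set w | _] = \bigcup_n \bigcap_m
    (if (n <= m)%N then [set w | label_count m x w = k] else setT)).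
  apply: bigcupT_measurable => n; apply: bigcapT_measurable => m.
  by case: ifP => _ //; exact: label_event_measurable.
apply/seteqP; split => w /=.
  by move/occupation_natP => [n H]; exists n => // m _; case: ifP => // /H.
move=> [n _ H]; apply/occupation_natP; exists n => m nm.
by have := H m I; rewrite nm.
Qed.

Lemma sum_poisson_mass : (\sum_(k <oo) (poisson_mass lambda k)%:E = 1)%E.
Proof.
have := @poisson_pgf R lambda 1 l0 ler01.
rewrite subrr mulr0 expR0 => <-; apply: eq_eseriesr => k _.
by rewrite expr1n mulr1.
Qed.

(** The Poisson masses sum to 1, which leaves probability 0 for an infinite occupation number. *)
Lemma occupation_ae_finite x :
  {ae P, forall w, exists k : nat, occupation R eta0 x w = k%:R%:E}.
Proof.
have mU : measurable (\bigcup_k [set w | occupation R eta0 x w = k%:R%:E]).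
  by apply: bigcupT_measurable => k; exact: occupation_event_measurable.
have PU : P (\bigcup_k [set w | occupation R eta0 x w = k%:R%:E]) = 1%E.
  rewrite measure_bigcup//=.
  - rewrite (eq_eseriesl (Q := xpredT)); last by move=> k; rewrite in_setT.
    rewrite -sum_poisson_mass; apply: eq_eseriesr => k _.
    exact: (pts_poisson Heta).
  - by move=> k _; exact: occupation_event_measurable.
  - by move=> i j _ _ [w [/= -> [] /eqP]]; rewrite eqr_nat => /eqP.
exists (~` \bigcup_k [set w | occupation R eta0 x w = k%:R%:E]); split.
- exact: measurableC.
- by rewrite probability_setC// PU subee.
- by move=> w /= H [k _ Hk]; apply: H; exists k.
Qed.

Section PowerOccupation.
Variable u : R.
Hypothesis u1 : 1 <= u.

(* Junk value [0] on the null event that the occupation number is infinite. *)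
Definition pow_occ (x : lattice d) (w : Om) : R :=
  if `[< exists k : nat, occupation R eta0 x w = k%:R%:E >]
  then u ^+ Num.trunc (fine (occupation R eta0 x w)) else 0.

Let u0 k : 0 <= u ^+ k. Proof. by rewrite exprn_ge0// (le_trans ler01). Qed.

Lemma pow_occ_ge0 x w : 0 <= pow_occ x w.
Proof. by rewrite /pow_occ; case: ifP. Qed.

Lemma pow_occE x w k : occupation R eta0 x w = k%:R%:E -> pow_occ x w = u ^+ k.
Proof.
move=> E; rewrite /pow_occ asboolT; last by exists k.
by rewrite E /= natrK.
Qed.

Lemma pow_occ_repr x w : (pow_occ x w)%:E =
  (\sum_(k <oo) (u ^+ k * \1_[set w | occupation R eta0 x w = k%:R%:E] w)%:E)%E.
Proof.
have [[k0 Hk]|H] := pselect (exists k : nat, occupation R eta0 x w = k%:R%:E).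
  rewrite (pow_occE Hk) (@nneseriesD1 _ _ k0)//; last by move=> k _; rewrite lee_fin mulr_ge0.
  rewrite indicE mem_set// mulr1 eseries0 ?adde0// => k _ /= kk0.
  rewrite indicE memNset ?mulr0// /= Hk => -[] /eqP; rewrite eqr_nat => /eqP e.
  by move: kk0; rewrite e eqxx.
rewrite /pow_occ asboolF// eseries0// => k _ _.
by rewrite indicE memNset ?mulr0// => Hk; apply: H; exists k.
Qed.

Lemma expectation_pow_occ x :
  (\int[P]_w (pow_occ x w)%:E = (expR (lambda * (u - 1)))%:E)%E.
Proof.
have mind k : measurable [set w | occupation R eta0 x w = k%:R%:E].
  exact: occupation_event_measurable.
under eq_integral => w _ do rewrite pow_occ_repr.
rewrite integral_nneseries//; last 2 first.
- move=> k; apply/measurable_EFinP; apply: measurable_funM => //; exact: measurable_indic.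
- by move=> k w _; rewrite lee_fin mulr_ge0.
rewrite -poisson_pgf//; last by rewrite (le_trans ler01).
apply: eq_eseriesr => k _.
under eq_integral => w _ do rewrite EFinM.
rewrite ge0_integralZl//; last 2 first.
- exact: measurable_eindic.
- by rewrite lee_fin.
rewrite integral_indic// setIT mulrC EFinM; congr (_ * _)%E.
exact: (pts_poisson Heta).
Qed.

Lemma pow_occ_countably_simple x :
  countably_simple P (sigma_rv (occupation R eta0 x)) (pow_occ x).
Proof.
split; first exact: pow_occ_ge0.
  by rewrite expectation_pow_occ ltry.
exists (fun k => u ^+ k), (fun k => [set w | occupation R eta0 x w = k%:R%:E]); split => //.
- by move=> k; exact: occupation_event_measurable.
- by move=> k; exists [set k%:R%:E].
- exact: pow_occ_repr.
Qed.

End PowerOccupation.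
End Occupation.

(** * Probability that given sites are all closed *)

Lemma countably_simple1 (ds : measure_display) (Om : measurableType ds) (R : realType)
    (P : probability Om R) (F : set (set Om)) :
  F setT -> countably_simple P F (fun=> 1 : R).
Proof.
move=> FT; split => //; first by rewrite integral_cst//= mul1e probability_setT ltry.
exists (fun k => if k == 0%N then 1 else 0), (fun=> setT); split => //.
  by move=> k; case: ifP.
move=> w; rewrite (@nneseriesD1 _ _ 0%N)//=; last first.
  by move=> k _; rewrite lee_fin; case: ifP; rewrite ?mul1r ?mul0r.
rewrite indicE mem_set// mulr1 eseries0 ?adde0// => k _ /negbTE.
by rewrite /= => ->; rewrite mul0r.
Qed.

Lemma lee_prod (R : realDomainType) (I : Type) (r : seq I) (F G : I -> \bar R) :
  (forall i, 0 <= F i <= G i)%E -> (\prod_(i <- r) F i <= \prod_(i <- r) G i)%E.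
Proof.
move=> FG; suff /andP[] : (0 <= \prod_(i <- r) F i <= \prod_(i <- r) G i)%E by [].
elim/big_ind2 : _ => [|x x' y y' /andP[x0 xx'] /andP[y0 yy']|i _] //.
  by rewrite lee01 lexx.
by rewrite mule_ge0//= lee_pmul.
Qed.

Lemma prod_option_nth (R : comNzRingType) (V : eqType) (x0 : V) (K : seq V)
    (F : V -> R) (o : option V) (i : nat) :
  uniq K -> i = (if o is Some x then index x K else size K) ->
  (if (i < size K)%N then F (nth x0 K i) else 1) = \prod_(x <- K) F x ^+ (o == Some x).
Proof.
move=> uK ->; case: o => [x|]; last by rewrite ltnn big1.
rewrite index_mem; case: ifPn => xK.
  rewrite (bigD1_seq x)//= eqxx expr1 nth_index// big1 ?mulr1// => y.
  by rewrite eq_sym (inj_eq Some_inj) => /negbTE ->.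
rewrite big_seq big1// => y yK; rewrite (inj_eq Some_inj).
by case: eqP => // xy; move: xK; rewrite xy yK.
Qed.

Section Chernoff.
Context (ds : measure_display) (Om : measurableType ds) (R : realType).
Variables (P : probability Om R) (d : nat) (lambda : R).
Hypothesis l0 : 0 <= lambda.
Variables (eta0 : nat -> Om -> option (lattice d.+2)) (zeta : nat -> R -> Om -> lattice d.+2).
Hypothesis Heta : poisson_points P lambda eta0.
Hypothesis Hzeta : forall j, ct_srw P (zeta j).
Let Fam (o : option nat) := if o is Some j then sigma_process (@nonneg_times R) (zeta j)
      else sigma_process [set: nat] eta0.
Hypothesis Hind : mutually_independent P Fam.
Variables (L : nat) (T z g : R).
Hypothesis T0 : 0 <= T.
Hypothesis L0 : (0 < L)%N.
Hypothesis z1 : 1 <= z.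
Hypothesis g1 : 1 <= g.
Hypothesis zg : z <= g ^+ L.
Hypothesis half : (Eblock T (fun b => (@block_weight R d L z g b)%:E) <= (2^-1)%:E)%E.

(** Truncation to finitely many labels and starting points makes every product finite. The resulting
    bound does not depend on [n] and [K], hence survives the increasing limit to [closed_site]. *)
Definition closed_by (n : nat) (K : seq (lattice d.+2)) (a : nat * nat) : set Om :=
  [set w | exists j x, [/\ (j < n)%N, x \in K, eta0 j w = Some x & touch L T (zeta j) x a w]].

Definition closed_site (a : nat * nat) : set Om :=
  [set w | exists j x, eta0 j w = Some x /\ touch L T (zeta j) x a w].

Lemma closed_by_measurable n K a : measurable (closed_by n K a).
Proof.
rewrite (_ : closed_by n K a = \bigcup_j \bigcup_(x : lattice d.+2)
  (if (j < n)%N && (x \in K) then eta0 j @^-1` [set Some x] `&` touch L T (zeta j) x a else set0)).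
  apply: bigcupT_measurable => j; apply: bigcup_countType_measurable => x.
  case: ifP => _ //; apply: measurableI; first exact: (pts_measurable Heta).
  apply: (sigma_walk_measurable (Hzeta j)); exact: touch_sigma.
apply/seteqP; split => w.
  by move=> [j [x [jn xK e t]]]; exists j => //; exists x => //; rewrite jn xK.
by move=> [j _ [x _]]; case: ifP => // /andP[jn xK] [e t]; exists j, x.
Qed.

Section Finite.
Variables (n : nat) (K : seq (lattice d.+2)) (A : seq (nat * nat)).
Hypotheses (uK : uniq K) (uA : uniq A).
Local Notation slot := 'I_(size K).+1.

Let phi (x : lattice d.+2) : R := fine (excess L T z (columns A) A x).

Let phi0 x : 0 <= phi x.
Proof. by apply: fine_ge0; exact: excess_ge0. Qed.

Let slotof (j : nat) (w : Om) : slot :=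
  inord (if eta0 j w is Some x then index x K else size K).

Let slotofE j w : slotof j w = (if eta0 j w is Some x then index x K else size K) :> nat.
Proof. by rewrite inordK//; case: eta0 => // x; rewrite ltnS index_size. Qed.

Let Y (j : nat) (v : slot) (w : Om) : R :=
  if (v < size K)%N then z ^+ touches L T (zeta j) A (nth 0 K v) w else 1.

Let Phi (v : slot) : R := if (v < size K)%N then 1 + phi (nth 0 K v) else 1.

Let Y1 j v w : 1 <= Y j v w.
Proof. by rewrite /Y; case: ifP => // _; rewrite exprn_ege1. Qed.

Let Phi1 v : 1 <= Phi v.
Proof. by rewrite /Phi; case: ifP => // _; rewrite lerDl phi0. Qed.

Let slots (f : {ffun 'I_n -> slot}) : set Om :=
  [set w | forall j : 'I_n, slotof j w = f j].

Let famT o : Fam o setT.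
Proof.
have h (G : set (set Om)) : <<s G >> setT.
  by move=> M [[M0 MC MU] GM]; rewrite -(setD0 setT); exact: MC.
by case: o => [j|]; exact: h.
Qed.

Let slots_cap f : slots f = \bigcap_j (if insub j is Some i then
     eta0 (val (i : 'I_n)) @^-1` [set o | inord (if o is Some x then index x K else size K) = f i]
     else setT).
Proof.
apply/seteqP; split => w.
  by move=> H j _; case: insubP => // i _ _; exact: H.
by move=> H j; have := H (val j) I; rewrite valK.
Qed.

Let slots_sigma f : sigma_process [set: nat] eta0 (slots f).
Proof.
rewrite slots_cap.

 apply: sigma_generated_bigcap => j; case: insubP => [i _ _|_].
  by apply: sub_sigma_algebra; exists (val i) => //; eexists.
exact: (famT None).
Qed.

Let slots_measurable f : measurable (slots f).
Proof.
rewrite slots_cap; apply: bigcapT_measurable => j; case: insubP => [i _ _|_] //.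
exact: (discrete_rv_preimage _ (pts_measurable Heta (val i))).
Qed.

Let cs_Y j v : countably_simple P (sigma_process (@nonneg_times R) (zeta j)) (Y j v).
Proof.
rewrite /Y; case: (v < size K)%N.
  exact: (touches_countably_simple T0 (Hzeta j) L0 z1 g1 zg half _ uA).
exact: (countably_simple1 P (famT (Some j))).
Qed.

Let expectation_Y j v : (\int[P]_w (Y j v w)%:E <= (Phi v)%:E)%E.
Proof.
rewrite /Y /Phi; case: (v < size K)%N; last first.
  by rewrite integral_cst//= mul1e probability_setT.
have := expectation_touches L T0 (Hzeta j) z1 A (nth 0 K v).
rewrite EFinD /phi fineK//.
exact: (excess_fin T0 L0 z1 g1 zg half).
Qed.

Local Open Scope ereal_scope.

(** All positions are frozen by a single event of the initial configuration, so independence is used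
    only among the walks and between them and that configuration, never among the labelled
    positions. *)
Let expectation_slots (f : {ffun 'I_n -> slot}) :
  \int[P]_w ((\prod_(j : 'I_n) Y j (f j) w) * \1_(slots f) w)%:E <=
  (\prod_(j : 'I_n) Phi (f j))%:E * P (slots f).
Proof.
pose F o w : R := if o is Some j then
  (if insub j is Some i then Y j (f i) w else 1%R) else 1%R.
have cF o : countably_simple P (Fam o) (F o).
  case: o => [j|] /=; last exact: (countably_simple1 P (famT None)).
  rewrite /F; case: insubP => [i _ _|_]; first exact: cs_Y.
  exact: (countably_simple1 P (famT (Some j))).
pose s := [seq Some (val i) | i <- enum 'I_n].
have := @expectation_prod_event _ _ _ _ _ _ _ Hind cF s [:: None] (fun=> slots f).
have us : uniq (s ++ [:: None]).
  rewrite cat_uniq /= orbF andbT; apply/andP; split.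
    by rewrite map_inj_uniq ?enum_uniq// => i j [/val_inj].
  by apply/mapP => -[].
move=> /(_ us) H.
have HB i : i \in [:: None] -> Fam i (slots f) /\ measurable (slots f).
  by rewrite inE => /eqP ->; split; [exact: slots_sigma|exact: slots_measurable].
move: {H}(H HB).
have -> : \bigcap_(i in [set` [:: None : option nat]]) slots f = slots f.
  apply/seteqP; split => w; first by move=> /(_ None); apply; rewrite /= inE.
  by move=> ? ? _.
rewrite big_seq1 => H.
have FE w : (\prod_(i <- s) F i w = \prod_(j : 'I_n) Y j (f j) w)%R.
  by rewrite big_map big_enum; apply: eq_bigr => j _ /=; rewrite valK.
under eq_integral => w _ do rewrite -FE.
rewrite H; apply: lee_wpmul2r => //.
rewrite big_map big_enum -prodEFin; apply: lee_prod => j.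
rewrite /F valK expectation_Y andbT; apply: integral_ge0 => w _.
by rewrite lee_fin (le_trans ler01).
Qed.

(** Each site of [A] is touched by at least one particle, so the numbers of touched sites add up to
    at least [size A]. *)
Let cover_le w : (forall a, a \in A -> closed_by n K a w) ->
  (z ^+ size A <= \prod_(j : 'I_n) Y j (slotof j w) w)%R.
Proof.
move=> wA.
pose t (j : 'I_n) : nat := if (slotof j w < size K)%N then
   touches L T (zeta j) A (nth 0%R K (slotof j w)) w else 0%N.
have -> : (\prod_(j : 'I_n) Y j (slotof j w) w = z ^+ \sum_(j : 'I_n) t j)%R.
  by rewrite expr_sum; apply: eq_bigr => j _; rewrite /Y /t; case: ifP.
apply: ler_weXn2l => //.
pose q (j : 'I_n) a := (slotof j w < size K)%N && `[<touch L T (zeta j) (nth 0%R K (slotof j w)) a w>].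
have tE j : t j = count (q j) A.
  rewrite /t /q; case: ltnP => _ //=.
  by rewrite (eq_count (a2 := pred0)) ?count_pred0.
rewrite (eq_bigr _ (fun j _ => tE j)) -sum1_size.
rewrite (eq_bigr (fun j => \sum_(a <- A) q j a)%N); last first.
  by move=> j _; rewrite -sum1_count big_mkcond; apply: eq_bigr => a _; case: (q j a).
rewrite exchange_big/= !big_seq; apply: leq_sum => a aA.
have [j [x [jn xK e tx]]] := wA a aA.
rewrite (bigD1 (Ordinal jn))//= /q slotofE /= e index_mem xK /= nth_index//.
by rewrite asboolT.
Qed.

(** Regrouping by starting point replaces the labelled positions, whose joint law is not given, by
    occupation numbers, which are independent and Poisson. *)
Let prod_Phi_le w : (forall x, exists k : nat, occupation R eta0 x w = k%:R%:E) ->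
  (\prod_(j : 'I_n) Phi (slotof j w) <= \prod_(x <- K) pow_occ eta0 (1 + phi x) x w)%R.
Proof.
move=> wfin.
have -> : (\prod_(j : 'I_n) Phi (slotof j w) =
   \prod_(x <- K) (1 + phi x) ^+ label_count eta0 n x w)%R.
  transitivity (\prod_(x <- K) \prod_(j : 'I_n) (1 + phi x) ^+ (eta0 j w == Some x))%R.
    rewrite exchange_big/=; apply: eq_bigr => j _.
    exact: (prod_option_nth _ (fun x => 1 + phi x)%R uK (slotofE j w)).
  apply: eq_bigr => x _; rewrite -expr_sum /label_count -sum1_count; congr (_ ^+ _)%R.
  rewrite [RHS]big_mkcond -[in RHS](subn0 n) -/(index_iota 0 n) big_mkord.
  by apply: eq_bigr => j _; case: eqP.
apply: ler_prod => x _; rewrite exprn_ge0 ?addr_ge0//=.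
have [k Hk] := wfin x; rewrite (pow_occE _ Hk).
apply: ler_weXn2l; first by rewrite lerDl.
move/occupation_natP: Hk => [m Hm].
by rewrite -(Hm (maxn n m)) ?leq_maxr// label_count_le// leq_maxl.
Qed.

Let finite_excess_sum : (\sum_(x <- K) phi x <= (box_size L * size A)%:R * g ^+ (2 * L))%R.
Proof.
rewrite -lee_fin EFinM -sumEFin.
apply: le_trans (sum_excess L0 T0 z1 g1 zg half (columns A) uK uA).
apply: lee_sum => x _; rewrite /phi fineK//.
exact: (excess_fin T0 L0 z1 g1 zg half).
Qed.

Lemma finite_closed_sites_bound :
  P (\bigcap_(a in [set` A]) closed_by n K a) <=
  ((z^-1 * expR (lambda * ((box_size L)%:R * g ^+ (2 * L)))) ^+ size A)%:E.
Proof.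
set C := \bigcap_(a in _) _.
have mC : measurable C.
  by apply: fin_bigcap_measurable => // a _; exact: closed_by_measurable.
have z0 : (0 < z)%R by exact: lt_le_trans z1.
have pY0 (f : {ffun 'I_n -> slot}) w : (0 <= \prod_(j : 'I_n) Y j (f j) w)%R.
  by apply: prodr_ge0 => j _; rewrite (le_trans ler01).
have pPhi0 (f : {ffun 'I_n -> slot}) : (0 <= \prod_(j : 'I_n) Phi (f j))%R.
  by apply: prodr_ge0 => j _; rewrite (le_trans ler01).
have mY j v : measurable_fun setT (fun w => (Y j v w)%:E) by exact: cs_measurable (cs_Y j v).
have mpY (f : {ffun 'I_n -> slot}) :
    measurable_fun setT (fun w => ((\prod_(j : 'I_n) Y j (f j) w) * \1_(slots f) w)%:E).
  rewrite (_ : (fun w => _) = (fun w => (\prod_(j : 'I_n) Y j (f j) w)%:E *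
     (EFin \o \1_(slots f)) w)); last by apply/funext => w; rewrite EFinM.
  apply: emeasurable_funM; last exact: measurable_eindic.
  exact: (cs_prod_measurable _ (fun j => cs_Y (val j) (f j))).
have mPhi (f : {ffun 'I_n -> slot}) : measurable_fun setT
    (fun w => (\prod_(j : 'I_n) Phi (f j))%:E * (\1_(slots f) w)%:E).
  by apply: emeasurable_funM => //; exact: measurable_eindic.
have slot_self w : slots [ffun j : 'I_n => slotof j w] w by move=> j; rewrite ffunE.
(* Markov's inequality for [z] to the total number of touched sites, split according to the joint
   position of the labels. *)
have S1 : (z ^+ size A)%:E * P C <=
    \sum_(f : {ffun 'I_n -> slot}) (\prod_(j : 'I_n) Phi (f j))%:E * P (slots f).
  apply: (@le_trans _ _ (\sum_(f : {ffun 'I_n -> slot})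
     \int[P]_w ((\prod_(j : 'I_n) Y j (f j) w) * \1_(slots f) w)%:E)); last first.
    by apply: lee_sum => f _; exact: expectation_slots.
  rewrite -ge0_integral_sum//; last by move=> f w _; rewrite lee_fin mulr_ge0.
  have -> : P C = \int[P]_w (\1_C w)%:E by rewrite integral_indic// setIT.
  rewrite -ge0_integralZl//; [|exact: measurable_eindic|by rewrite lee_fin exprn_ge0// ltW].
  apply: ge0_le_integral => //.
  - by move=> w _; rewrite mule_ge0// lee_fin exprn_ge0// ltW.
  - by apply: emeasurable_funM => //; exact: measurable_eindic.
  - by apply: emeasurable_sum => f; exact: mpY.
  move=> w _; rewrite (bigD1 [ffun j : 'I_n => slotof j w])//= -[leLHS]adde0 leeD//; last first.
    by apply: sume_ge0 => f _; rewrite lee_fin mulr_ge0.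
  rewrite -EFinM lee_fin [in leRHS]indicE mem_set// mulr1 indicE.
  have [wC|wC] := boolP (w \in C); last by rewrite mulr0.
  rewrite mulr1; move/set_mem: wC => wC.
  by under eq_bigr => j _ do rewrite ffunE; exact: cover_le.
have S2 : \sum_(f : {ffun 'I_n -> slot}) (\prod_(j : 'I_n) Phi (f j))%:E * P (slots f) <=
    \int[P]_w (\prod_(x <- K) pow_occ eta0 (1 + phi x) x w)%:E.
  rewrite (_ : \sum_(f : {ffun 'I_n -> slot}) _ = \int[P]_w
      \sum_(f : {ffun 'I_n -> slot}) (\prod_(j : 'I_n) Phi (f j))%:E * (\1_(slots f) w)%:E); last first.
    rewrite ge0_integral_sum//; last by move=> f w _; rewrite mule_ge0 ?lee_fin.
    apply: eq_bigr => f _; rewrite ge0_integralZl//; [|exact: measurable_eindic|by rewrite lee_fin].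
    by rewrite integral_indic// setIT.
  have pc x : countably_simple P (sigma_rv (occupation R eta0 x)) (pow_occ eta0 (1 + phi x) x).
    by apply: (pow_occ_countably_simple l0 Heta); rewrite lerDl.
  apply: ae_ge0_le_integral => //.
  - by move=> w _; rewrite sume_ge0// => f _; rewrite mule_ge0 ?lee_fin.
  - by apply: emeasurable_sum => f; exact: mPhi.
  - by move=> w _; rewrite lee_fin prodr_ge0// => x _; exact: cs_ge0 (pc x) w.
  - exact: (cs_prod_measurable K pc).
  have aeK : {ae P, forall w, forall x : lattice d.+2, exists k : nat, occupation R eta0 x w = k%:R%:E}.
    have H k : {ae P, forall w, if @unpickle (lattice d.+2) k is Some x then
        exists i : nat, occupation R eta0 (x : lattice d.+2) w = i%:R%:E else True}.
      case: unpickle => [x|]; last exact: aeW.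
      exact: (occupation_ae_finite l0 Heta x).
    by apply: filterS (ae_foralln H) => w Hw x; have := Hw (pickle x); rewrite pickleK.
  apply: filterS aeK => w wfin _.
  rewrite (bigD1 [ffun j : 'I_n => slotof j w])//= [X in (_ + X)%E]big1 ?adde0; last first.
    move=> f fw; rewrite indicE memNset ?mule0// => wf; move/eqP: fw; apply.
    by apply/ffunP => j; rewrite ffunE wf.
  rewrite indicE mem_set// mule1 lee_fin.
  by under eq_bigr => j _ do rewrite ffunE; exact: prod_Phi_le.
(* The Poisson generating function at [1 + phi x] is [expR (lambda * phi x)]; the 1 subtracted in
   [excess] reappears here and cancels. *)
have S3 : \int[P]_w (\prod_(x <- K) pow_occ eta0 (1 + phi x) x w)%:E =
    (expR (lambda * \sum_(x <- K) phi x))%:E.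
  have pc x : countably_simple P (sigma_rv (occupation R eta0 x)) (pow_occ eta0 (1 + phi x) x).
    by apply: (pow_occ_countably_simple l0 Heta); rewrite lerDl.
  rewrite (expectation_prod (pts_independent Heta) pc)//.
  under eq_bigr => x _ do rewrite (expectation_pow_occ l0 Heta) ?lerDl// addrAC subrr add0r.
  by rewrite prodEFin mulr_sumr expR_sum.
have : (z ^+ size A)%:E * P C <=
    ((expR (lambda * ((box_size L)%:R * g ^+ (2 * L)))) ^+ size A)%:E.
  apply: (le_trans S1); apply: (le_trans S2); rewrite S3 lee_fin -expRM_natl ler_expR.
  rewrite [leRHS]mulrCA ler_wpM2l// mulrA -natrM mulnC.
  exact: finite_excess_sum.
have PCf : P C \is a fin_num by rewrite fin_num_measure.
rewrite -(fineK PCf) -EFinM !lee_fin => H.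
by rewrite exprMn exprVn mulrC ler_pdivlMr ?exprn_gt0// mulrC.
Qed.

End Finite.

Let K (n : nat) : seq (lattice d.+2) := undup (pmap unpickle (iota 0 n)).

Let mem_K n x : (pickle x < n)%N -> x \in K n.
Proof.
move=> xn; rewrite mem_undup mem_pmap; apply/mapP; exists (pickle x).
  by rewrite mem_iota.
by rewrite pickleK.
Qed.

Let sub_K n m : (n <= m)%N -> {subset K n <= K m}.
Proof.
move=> nm x; rewrite !mem_undup !mem_pmap => /mapP[k + e].
rewrite mem_iota => /andP[_ kn]; apply/mapP; exists k => //.
by rewrite mem_iota (leq_trans kn).
Qed.

Let closed_by_homo n m a : (n <= m)%N -> closed_by n (K n) a `<=` closed_by m (K m) a.
Proof.
move=> nm w [j [x [jn xK e t]]]; exists j, x; split => //.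
  exact: leq_trans nm.
exact: (sub_K nm).
Qed.

Lemma closed_site_bigcup a : closed_site a = \bigcup_n closed_by n (K n) a.
Proof.
apply/seteqP; split => w.
  move=> [j [x [e t]]]; exists (maxn j (pickle x)).+1 => //; exists j, x; split => //.
    by rewrite ltnS leq_maxl.
  by apply: mem_K; rewrite ltnS leq_maxr.
by move=> [n _ [j [x [_ _ e t]]]]; exists j, x.
Qed.

Lemma closed_site_measurable a : measurable (closed_site a).
Proof.
rewrite closed_site_bigcup; apply: bigcupT_measurable => n.
exact: closed_by_measurable.
Qed.

Lemma closed_sites_bound (A : seq (nat * nat)) : uniq A ->
  (P (\bigcap_(a in [set` A]) closed_site a) <=
  ((z^-1 * expR (lambda * ((box_size L)%:R * g ^+ (2 * L)))) ^+ size A)%:E)%E.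
Proof.
move=> uA; pose C n := \bigcap_(a in [set` A]) closed_by n (K n) a.
have mC n : measurable (C n).
  by apply: fin_bigcap_measurable => // a _; exact: closed_by_measurable.
have -> : \bigcap_(a in [set` A]) closed_site a = \bigcup_n C n.
  apply/seteqP; split => w; last first.
    by move=> [n _ H] a aA; rewrite closed_site_bigcup; exists n => //; exact: H.
  rewrite /C => H.
  (* As [A] is finite and truncations increase, one truncation serves all of its sites. *)
  have [n Hn] : exists n, forall a, a \in A -> closed_by n (K n) a w.
    elim: (A) H => [|a s IH] H; first by exists 0%N.
    have [n Hn] : exists n, forall b, b \in s -> closed_by n (K n) b w.
      by apply: IH => b /= bs; apply: H; rewrite /= inE bs orbT.
    have : closed_site a w by apply: H; rewrite /= mem_head.
    rewrite closed_site_bigcup => -[m _ Hm]; exists (maxn n m) => b.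
    rewrite inE => /orP[/eqP ->|bs].
      exact: (closed_by_homo (leq_maxr n m) Hm).
    exact: (closed_by_homo (leq_maxl n m) (Hn b bs)).
  by exists n => // a aA; exact: Hn.
have mU : measurable (\bigcup_n C n) by exact: bigcupT_measurable.
have hC : {homo C : n m / (n <= m)%N >-> (n <= m)%O}.
  move=> n m nm; apply/subsetPset => w H a aA.
  exact: (closed_by_homo nm (H a aA)).
have cv := nondecreasing_cvg_mu (mu := P) mC mU hC.
rewrite -(cvg_lim _ cv)//; apply: lime_le; first exact: cvgP cv.
apply: nearW => n; apply: finite_closed_sites_bound => //; exact: undup_uniq.
Qed.
End Chernoff.

(** * Lipschitz percolation *)

Section LipschitzPercolation.
Variable C : nat * nat -> Prop.

(* The sites below the bottom row count as reached: an upward step must enter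
   a closed site, a downward diagonal step is free. *)
Inductive reached : nat * nat -> Prop :=
| reached_bottom i : C (i, 0%N) -> reached (i, 0%N)
| reached_up i h : C (i, h.+1) -> reached (i, h) -> reached (i, h.+1)
| reached_left i h : reached (i.+1, h.+1) -> reached (i, h)
| reached_right i h : reached (i, h.+1) -> reached (i.+1, h).

(** Below [F i] everything is reached, so an upward step into a closed [(i, F i)] would reach it
    too. Each diagonal move gives one of the two Lipschitz bounds; [reached_left] also carries
    unreached heights from the origin to every column. *)
Lemma lipschitz_open_path : ~ reached (0%N, 0%N) ->
  exists F : nat -> nat, [/\ F 0%N = 0%N, forall i, ~ C (i, F i) &
    forall i, (F i.+1 <= (F i).+1)%N /\ (F i <= (F i.+1).+1)%N].
Proof.
move=> n00.
have ex i : exists h, ~ reached (i, h).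
  elim: i => [|i [h nh]]; first by exists 0%N.
  by exists h.+1 => r; apply: nh; exact: reached_left.
have exmin i : exists h, ~ reached (i, h) /\ forall h', ~ reached (i, h') -> (h <= h')%N.
  have exb : exists h, `[< ~ reached (i, h) >].
    by have [h nh] := ex i; exists h; apply/asboolP.
  case: (ex_minnP exb) => h /asboolP nh hmin; exists h; split => // h' nh'.
  by apply: hmin; apply/asboolP.
have [F HF] := choice exmin.
have nF i : ~ reached (i, F i) by have [] := HF i.
have Fmin i h : ~ reached (i, h) -> (F i <= h)%N by have [_] := HF i; exact.
have below i h : (h < F i)%N -> reached (i, h).
  by move=> hF; apply: contrapT => /Fmin; rewrite leqNgt hF.
exists F; split => [|i Ci|i].
- by apply/eqP; rewrite -leqn0; exact: Fmin.
- case E : (F i) Ci => [|h] Ci; apply: (nF i); rewrite E.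
    exact: reached_bottom.
  by apply: reached_up => //; apply: below; rewrite E.
- split; first by apply: Fmin => r; apply: (nF i); exact: reached_left.
  rewrite leqNgt; apply/negP => /below r.
  by apply: (nF i.+1); exact: reached_right.
Qed.

End LipschitzPercolation.

(* [walks] enumerates paths run backwards; the truncated predecessors only add
   spurious paths. [ups] lists the sites entered by upward steps, the last one
   coming from below the bottom row. *)
Definition nbrs (s : nat * nat) : seq (nat * nat) :=
  [:: (s.1, s.2.-1); (s.1.+1, s.2.+1); (s.1.-1, s.2.+1)].

Fixpoint walks (s : nat * nat) (n : nat) : seq (seq (nat * nat)) :=
  if n is n'.+1 then flatten [seq [seq y :: p | p <- walks y n'] | y <- nbrs s]
  else [:: [::]].

Fixpoint ups (s : nat * nat) (p : seq (nat * nat)) : seq (nat * nat) :=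
  if p is y :: p' then if (y.2 < s.2)%N then s :: ups y p' else ups y p' else [:: s].

Lemma size_walks s n : size (walks s n) = (3 ^ n)%N.
Proof.
elim: n s => [|n IH] s //=.
by rewrite !size_cat !size_map !IH /= expnS; lia.
Qed.

(** Consequently a walk without repeated vertices enters distinct closed sites, as the bound for [k]
    given sites requires. *)
Lemma ups_subseq s p : subseq (ups s p) (s :: p).
Proof.
elim: p s => [|y p IH] s //=; first by rewrite eqxx.
case: ifP => _; first by rewrite eqxx; exact: IH.
exact: subseq_trans (IH y) (subseq_cons _ _).
Qed.

Section Walks.
Variable C : nat * nat -> Prop.

Definition walk_step : rel (nat * nat) := fun s y =>
  [|| [&& y.1 == s.1, s.2 == y.2.+1 & `[< C s >]],
      (y.1 == s.1.+1) && (y.2 == s.2.+1) |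
      (s.1 == y.1.+1) && (y.2 == s.2.+1)].

Lemma reached_walk s : reached C s -> exists p, [/\ path walk_step s p,
   (last s p).2 = 0%N & C (last s p)].
Proof.
elim=> [i Ci|i h Ci _ [p [pp p0 pC]]|i h _ [p [pp p0 pC]]|i h _ [p [pp p0 pC]]].
- by exists [::].
- exists ((i, h) :: p); split => //=; rewrite pp andbT /walk_step /= !eqxx /=.
  by rewrite asboolT.
- by exists ((i.+1, h.+1) :: p); split => //=; rewrite pp andbT /walk_step /= !eqxx !orbT.
- by exists ((i, h.+1) :: p); split => //=; rewrite pp andbT /walk_step /= !eqxx !orbT.
Qed.

Lemma walk_in_walks s p : path walk_step s p -> p \in walks s (size p).
Proof.
elim: p s => [|y p IH] s //= /andP[sy /IH py].
have : y \in nbrs s.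
  rewrite /nbrs !inE /=; case: y s sy {py IH} => [y1 y2] [s1 s2]; rewrite /walk_step /= !xpair_eqE.
  case/or3P => [/and3P[/eqP -> /eqP -> _]|/andP[/eqP -> /eqP ->]|/andP[/eqP -> /eqP ->]];
    by rewrite /= !eqxx ?orbT.
move=> yn; suff : y :: p \in flatten [seq [seq x :: q | q <- walks x (size p)] | x <- nbrs s] by [].
apply/flattenP; exists [seq y :: q | q <- walks y (size p)].
  by apply/mapP; exists y.
by apply/mapP; exists p.
Qed.

(** Height balance: upward minus downward steps make [s.2], their sum is [size p], and [ups] has one
    extra entry for coming from below the bottom row. *)
Lemma walk_size_ups s p : path walk_step s p -> (last s p).2 = 0%N ->
  (2 * size (ups s p) = size p + s.2 + 2)%N.
Proof.
elim: p s => [|y p IH] s /=; first by move=> _ ->.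
move=> /andP[sy py] /(IH _ py) e.
case/or3P: sy => [/and3P[_ /eqP -> _]|/andP[_ /eqP e2]|/andP[_ /eqP e2]].
- by rewrite ltnSn /=; lia.
- by rewrite e2 ltnNge leqnSn /=; lia.
- by rewrite e2 ltnNge leqnSn /=; lia.
Qed.

Lemma walk_ups_closed s p : path walk_step s p -> C (last s p) ->
  forall a, a \in ups s p -> C a.
Proof.
elim: p s => [|y p IH] s /=; first by move=> _ Cs a; rewrite inE => /eqP ->.
move=> /andP[sy py] /(IH _ py) H a; case: ifP => ys; last exact: H.
rewrite inE => /orP[/eqP ->|]; last exact: H.
case/or3P: sy => [/and3P[_ _ /asboolP]//|/andP[_ /eqP e2]|/andP[_ /eqP e2]];
  by move: ys; rewrite e2 ltnNge leqnSn.
Qed.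

Lemma reached_simple_walk s : reached C s -> exists n p,
  [/\ p \in walks s n, uniq (ups s p), (2 * size (ups s p) = n + s.2 + 2)%N &
      forall a, a \in ups s p -> C a].
Proof.
(* Loop erasure keeps the last vertex and makes the vertices distinct. *)
move=> /reached_walk[p []]; case/shortenP => p' pp' up' _ p0 pC.
exists (size p'), p'; split.
- exact: walk_in_walks.
- exact: subseq_uniq (ups_subseq s p') up'.
- exact: walk_size_ups.
- exact: walk_ups_closed.
Qed.

End Walks.

(** * Union bound over backward paths *)

Section UnionBound.
Context (ds : measure_display) (Om : measurableType ds) (R : realType).
Variables (P : probability Om R) (D : nat * nat -> set Om).
Hypothesis mD : forall a, measurable (D a).
Hypothesis PD : forall A, uniq A ->
  (P (\bigcap_(a in [set` A]) D a) <= ((144^-1) ^+ size A)%:E)%E.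

(** Lists with repeated entries or the wrong number of upward steps get the empty event, so one
    bound holds for every member of [walks]. *)
Let walk_event (n : nat) (p : seq (nat * nat)) : set Om :=
  if uniq (ups (0, 0)%N p) && (2 * size (ups (0, 0)%N p) == n + 2)%N
  then \bigcap_(a in [set` ups (0, 0)%N p]) D a else set0.

Let walk_event_measurable n p : measurable (walk_event n p).
Proof.
by rewrite /walk_event; case: ifP => // _; apply: fin_bigcap_measurable.
Qed.

Let P_walk_event n p : (P (walk_event n p) <= (12^-1 ^+ (n + 2))%:E)%E.
Proof.
rewrite /walk_event; case: ifP => [/andP[up /eqP sz]|_]; last first.
  by rewrite measure0 lee_fin exprn_ge0.
rewrite (le_trans (PD up))// -sz exprM lee_fin lerXn2r ?nnegrE ?exprn_ge0//.
by lra.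
Qed.

(** A path of [n] steps forces [(n + 2) / 2] closed sites and so costs [12^-1 ^+ (n + 2)]; with
    [3 ^ n] candidates this is a geometric series of ratio [4^-1]. A measurable event containing the
    one of interest is enough. *)
Lemma reached_origin_event : exists E : set Om, [/\ measurable E, (P E < 1)%E &
  forall w, reached (fun a => D a w) (0, 0)%N -> E w].
Proof.
pose En n := \big[setU/set0]_(p <- walks (0, 0)%N n) walk_event n p.
have mE n : measurable (En n) by apply: bigsetU_measurable.
exists (\bigcup_n En n); split.
- exact: bigcupT_measurable.
- apply: (@le_lt_trans _ _ (2^-1)%:E); last by rewrite lte_fin invf_lt1// ltr1n.
  apply: (le_trans (measure_sigma_subadditive P mE (bigcupT_measurable _ mE) (@subset_refl _ _))).
  have half0 : 0 <= 2^-1 :> R by [].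
  apply: le_trans (epsilon_trick0 xpredT half0).
  apply: lee_nneseries => [n _ _|n _] //.
  apply: (@le_trans _ _ (\sum_(p <- walks (0, 0)%N n) P (walk_event n p))%E).
    rewrite /En; elim: (walks _ _) => [|p s IH]; first by rewrite !big_nil measure0.
    rewrite !big_cons (le_trans (measureU2 _ _ _))// ?leeD2l//.
    by apply: bigsetU_measurable.
  apply: (@le_trans _ _ (\sum_(p <- walks (0, 0)%N n) (12^-1 ^+ (n + 2))%:E)%E).
    by apply: lee_sum => p _; exact: P_walk_event.
  have -> : (\sum_(p <- walks (0, 0)%N n) (12^-1 ^+ (n + 2))%:E)%E =
      ((3 ^ n)%:R * 12^-1 ^+ (n + 2) : R)%:E.
    by rewrite sumEFin big_const_seq count_predT size_walks iter_addr_0 mulr_natl.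
  rewrite lee_fin.
  have -> : (3 ^ n)%:R * 12^-1 ^+ (n + 2) = 2^-1 ^+ n * 2^-1 ^+ n * 12^-1 ^+ 2 :> R.
    rewrite natrX exprD mulrA; congr (_ * _); rewrite -!exprMn; congr (_ ^+ _).
    by field.
  have -> : 2^-1 / (2 ^ n.+1)%:R = 4^-1 * 2^-1 ^+ n :> R.
    by rewrite natrX exprS exprVn; field; rewrite expf_neq0.
  have h1 : (2^-1 : R) ^+ n <= 1 by rewrite exprn_ile1// invf_le1// ler1n.
  have h0 : 0 <= (2^-1 : R) ^+ n by rewrite exprn_ge0.
  by rewrite [12^-1 ^+ 2]expr2; nra.
move=> w /reached_simple_walk[n [p [pn up sz pD]]]; exists n => //.
rewrite /En -bigcup_seq; exists p => //.
rewrite /walk_event up sz /= addn0 eqxx => a aup; exact: pD.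
Qed.

End UnionBound.

(** * The target *)

Section Target.
Variables (d L : nat) (F : nat -> nat).
Hypothesis L0 : (0 < L)%N.
Hypothesis F0 : F 0%N = 0%N.
Hypothesis FL : forall i, (F i.+1 <= (F i).+1)%N /\ (F i <= (F i.+1).+1)%N.
Local Notation lat := (lattice d.+2).

Definition planar (u v : int) : lat :=
  \row_c (if c == c0 d then u else if c == c1 d then v else 0).

Lemma planar0 u v : planar u v ord0 (c0 d) = u.
Proof. by rewrite mxE eqxx. Qed.

Lemma planar1 u v : planar u v ord0 (c1 d) = v.
Proof. by rewrite mxE. Qed.

Lemma l1norm_planar u v u' v' :
  l1norm (planar u v - planar u' v') = (absz (u - u')%R + absz (v - v')%R)%N.
Proof.
rewrite /l1norm (bigD1 (c0 d))//= (bigD1 (c1 d))//= big1.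
  by rewrite !mxE !eqxx addn0.
by move=> c /andP[/negbTE n0 /negbTE n1]; rewrite !mxE n0 n1 subr0.
Qed.

Lemma l1norm_triangle (x y z : lat) : (l1norm (x - z) <= l1norm (x - y) + l1norm (y - z))%N.
Proof.
rewrite /l1norm -big_split/=; apply: leq_sum => i _; rewrite !mxE.
by move: (x _ _) (y _ _) (z _ _) => a b c; lia.
Qed.

(* Block [m] consists of [L] jumps along the first axis followed by [L] moves
   towards the new height; [r - L] is truncated. *)
Definition target_pos (k : nat) : lat :=
  let m := (k %/ (2 * L))%N in let r := (k %% (2 * L))%N in
  planar (m * L + minn r L)%N%:Z
    ((F m * L)%N%:Z + ((F m.+1)%:Z - (F m)%:Z) * (r - L)%N%:Z).

Lemma target_pos0 : target_pos 0 = 0.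
Proof.
rewrite /target_pos div0n mod0n F0 !mul0n min0n sub0n mulr0 addr0.
by apply/rowP => c; rewrite !mxE; case: ifP => //; case: ifP.
Qed.

Lemma target_pos_step k : (l1norm (target_pos k.+1 - target_pos k) <= 1)%N.
Proof.
have L20 : (0 < 2 * L)%N by rewrite muln_gt0.
rewrite /target_pos; set m := (k %/ (2 * L))%N; set r := (k %% (2 * L))%N.
have kE : k = (m * (2 * L) + r)%N by exact: divn_eq.
have r2L : (r < 2 * L)%N by exact: ltn_pmod.
have [h1 h2] := FL m.
have [rL|rL] := ltnP r.+1 (2 * L).
  have -> : (k.+1 %/ (2 * L))%N = m.
    by rewrite kE -addnS divnMDl// divn_small// addn0.
  have -> : (k.+1 %% (2 * L))%N = r.+1.
    by rewrite kE -addnS modnMDl modn_small.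
  rewrite l1norm_planar.
  have [rL'|rL'] := ltnP r L.
    have -> : (r.+1 - L = 0)%N by apply/eqP; rewrite subn_eq0.
    have -> : (r - L = 0)%N by apply/eqP; rewrite subn_eq0 ltnW.
    by rewrite subrr; lia.
  have -> : (r.+1 - L)%N%:Z = (r - L)%N%:Z + 1 by lia.
  by rewrite mulrDr mulr1; lia.
(* At the last index of a block the height is still one move short of [F m.+1 * L]; that move is the
   passage to index 0 of block [m.+1]. *)
have rE : r = (2 * L).-1 by lia.
have -> : (k.+1 %/ (2 * L))%N = m.+1.
  by rewrite kE -addnS rE prednK// divnMDl// divnn L20 addn1.
have -> : (k.+1 %% (2 * L))%N = 0%N.
  by rewrite kE -addnS rE prednK// modnMDl modnn.
rewrite l1norm_planar rE min0n sub0n mulr0 addr0 addn0.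
have -> : ((2 * L).-1 - L = L.-1)%N by lia.
have -> : minn (2 * L).-1 L = L by lia.
have e : ((F m.+1 * L)%N%:Z = (F m.+1)%:Z * L.-1%:Z + (F m.+1)%:Z).
  by rewrite -[in LHS](prednK L0) mulnS; lia.
have e' : ((F m * L)%N%:Z = (F m)%:Z * L.-1%:Z + (F m)%:Z).
  by rewrite -[in LHS](prednK L0) mulnS; lia.
by rewrite e e' mulSn mulrBl; lia.
Qed.

Lemma target_pos_lipschitz k k' : (k <= k')%N ->
  (l1norm (target_pos k' - target_pos k) <= k' - k)%N.
Proof.
move=> kk'; rewrite -(subnKC kk') addKn; elim: (k' - k)%N => [|n IH].
  by rewrite addn0 subrr /l1norm big1// => i _; rewrite mxE.
rewrite addnS; apply: leq_trans (l1norm_triangle _ (target_pos (k + n)) _) _.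
by have := target_pos_step (k + n); lia.
Qed.

Lemma target_pos_box k : box L ((k %/ (2 * L))%N, F (k %/ (2 * L))%N) (target_pos k).
Proof.
have L20 : (0 < 2 * L)%N by rewrite muln_gt0.
rewrite /target_pos; set m := (k %/ (2 * L))%N; set r := (k %% (2 * L))%N.
have r2L : (r < 2 * L)%N by exact: ltn_pmod.
have [h1 h2] := FL m.
rewrite /box planar0 planar1 /=.
have D1 : ((F m.+1)%:Z - (F m)%:Z <= 1) by lia.
have D2 : (-1 <= (F m.+1)%:Z - (F m)%:Z) by lia.
set D := (F m.+1)%:Z - _ in D1 D2 *.
have rL : (r - L)%N%:Z <= L%:Z by lia.
have r0 : 0 <= (r - L)%N%:Z :> int by [].
move: (r - L)%N%:Z r0 rL => e e0 eL.
apply/and5P; split.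
- lia.
- by rewrite mulSn; lia.
- by nia.
- by rewrite mulSn; nia.
by apply/forallP => c; apply/implyP => /andP[/negbTE n0 /negbTE n1]; rewrite mxE n0 n1.
Qed.

Variables (R : realType) (tau S : R).
Hypothesis S0 : 0 < S.
Hypothesis tauE : tau = 2 / S.

Definition target (t : R) : lat := target_pos (Num.trunc (t / tau)).

Let tau0 : 0 < tau. Proof. by rewrite tauE divr_gt0. Qed.

(** The pause [2 / S] is twice what speed [S] suggests because jumps are instantaneous: [n] jumps
    may occur in little more than [n - 1] pauses, and [2 * (n - 1) >= n] once [n >= 2]. A single
    jump is allowed by the 1 in the maximum. *)
Lemma target_speed : trajectory_speed S target.
Proof.
have ttau (t : R) : 0 <= t -> 0 <= t / tau by move=> t0; rewrite divr_ge0// ltW.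
split; [split|].
- by rewrite /target mul0r trunc0 target_pos0.
- move=> t xi t0 xi0 H.
  set k := Num.trunc (t / tau).
  have /andP[k1 k2] := truncn_itv (ttau t t0).
  (* The target rests until its next jump, so shortly after [t] its distance from [target t] is
     0. *)
  pose e := Num.min xi (k.+1%:R * tau - t).
  have e0 : 0 < e.
    by rewrite /e lt_min xi0 subr_gt0 -ltr_pdivrMr.
  have e2 : e / 2 < e by rewrite ltr_pdivrMr// ltr_pMr// ltr1n.
  exists (e / 2); split; first by rewrite divr_gt0.
    by rewrite (lt_le_trans e2)// /e ge_min lexx.
  rewrite (_ : target (t + e / 2) = target t).
    by rewrite subrr {1}/l1norm big1 ?(ltn_trans _ H)// => i _; rewrite mxE.
  rewrite /target -/k; congr target_pos; apply: truncn_def.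
  rewrite ler_pdivlMr// ltr_pdivrMr//; apply/andP; split.
    by rewrite -ler_pdivlMr// (le_trans k1)// ler_pM2r ?invr_gt0// lerDl divr_ge0// ltW.
  rewrite -ltrBrDl (lt_le_trans e2)// /e ge_min lexx orbT//.
- move=> t xi t0 xi0.
  set k := Num.trunc (t / tau); set k' := Num.trunc ((t + xi) / tau).
  have /andP[k1 k2] := truncn_itv (ttau t t0).
  have txi0 : 0 <= t + xi by rewrite addr_ge0// ltW.
  have /andP[k1' k2'] := truncn_itv (ttau _ txi0).
  have kk' : (k <= k')%N.
    by apply: le_truncn; rewrite ler_pM2r ?invr_gt0// lerDl ltW.
  apply: (@le_trans _ _ (k' - k)%:R).
    by rewrite ler_nat target_pos_lipschitz.
  rewrite le_max; have [k2k|k2k] := leqP (k' - k) 1; first by rewrite lern1 k2k orbT.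
  apply/orP; left.
  have H : (k' - k.+1)%:R < xi / tau.
    rewrite natrB; last by lia.
    rewrite ltrBlDr; apply: (le_lt_trans k1'); rewrite mulrDl addrC ltrD2l//.
  have xS : xi * S = 2 * (xi / tau).
    by rewrite tauE; field; rewrite gt_eqF.
  rewrite xS; apply: (@le_trans _ _ (2 * (k' - k.+1)%:R)); last by rewrite ler_pM2l// ltW.
  by rewrite -natrM ler_nat; lia.
Qed.

Lemma target_box (t : R) : 0 <= t -> exists m : nat,
  [/\ m%:R * ((2 * L)%:R * tau) <= t, t < m.+1%:R * ((2 * L)%:R * tau) &
      box L (m, F m) (target t)].
Proof.
move=> t0; have ttau : 0 <= t / tau by rewrite divr_ge0// ltW.
have /andP[k1 k2] := truncn_itv ttau.
rewrite /target; set k := Num.trunc _ in k1 k2 *.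
have L20 : (0 < 2 * L)%N by rewrite muln_gt0.
exists (k %/ (2 * L))%N; split; last exact: target_pos_box.
  rewrite mulrA -ler_pdivlMr// (le_trans _ k1)// -natrM ler_nat.
  exact: leq_trunc_div.
rewrite mulrA -ltr_pdivrMr// (lt_le_trans k2)// -natrM ler_nat.
by rewrite ltn_ceil.
Qed.

End Target.

(** * From open paths to undetected targets *)

Lemma walk_rational_time (ds : measure_display) (Om : measurableType ds) (R : realType)
    (P : probability Om R) (d : nat) (zeta : R -> Om -> lattice d) w (t u : R) :
  ct_srw P zeta -> 0 <= t -> t < u ->
  exists q : rat, [/\ t <= ratr q, ratr q < u & zeta (ratr q) w = zeta t w].
Proof.
move=> [N [xi [HN _ _ zE]]] t0 tu.
have := pp_right_continuous HN w t0.
rewrite /at_right /within /= => /nbhs_ballP[e /= e0 He].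
have tm : t < Num.min u (t + e) by rewrite lt_min tu ltrDl.
have [q] := rat_in_itvoo tm; rewrite in_itv/= => /andP[q1 q2].
move: q2; rewrite lt_min => /andP[q2 q3].
exists q; split => //; first exact: ltW.
rewrite !zE//; last by rewrite (le_trans t0)// ltW.
rewrite He//=; rewrite /ball /= distrC gtr0_norm ?subr_gt0//.
by rewrite ltrBlDl.
Qed.

Theorem theorem1p1 (R : realType) (d : nat) (S : R)
    (M : forall lambda : {nonneg R}, particle_system d lambda%:num) :
  (2 <= d)%N -> 0 < S -> (0 < lambda_det M S)%E.
Proof.
case: d M => [|[|d]] M // _ S0.
(* The union bound asks for 144; the factor 2 absorbs [expR (lambda%:num * C)]. *)
pose z : R := 2 * 144.
have z1 : 1 <= z by rewrite /z -natrM ler1n.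
have z0 : 0 < z by exact: lt_le_trans z1.
(* A block consists of [2 * L] pauses of length [2 / S], hence lasts [4 / S * L%:R]. *)
have tau0 : 0 < 4 / S by rewrite divr_gt0.
have [L [g [L0 g1 zg half]]] := exists_scale d tau0 z1.
set T := 4 / S * L%:R in half.
have T0 : 0 <= T by rewrite mulr_ge0// ltW.
pose C := (box_size L)%:R * g ^+ (2 * L).
have g0 : 0 < g by exact: lt_le_trans g1.
have C0 : 0 < C by rewrite mulr_gt0 ?exprn_gt0// ltr0n /box_size muln_gt0.
(* Below this intensity [lambda%:num * C] is at most [2^-1], and [expR 2^-1 <= 2]. *)
pose l0 : R := 2^-1 / C.
have l00 : 0 < l0 by rewrite divr_gt0.
apply: (@lt_le_trans _ _ l0%:E); first by rewrite lte_fin.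
apply: le_ereal_inf_tmp => _ [lambda Hdet <-]; rewrite lee_fin leNgt; apply/negP => lam.
set X := M lambda in Hdet *.
have lam0 : 0 <= lambda%:num by [].
have bound A : uniq A -> (ps_prob X (\bigcap_(a in [set` A])
    closed_site (ps_eta0 X) (ps_zeta X) L T a) <= ((144^-1) ^+ size A)%:E)%E.
  move=> uA; have H := closed_sites_bound lam0 (ps_points X) (ps_walks X) (@ps_independent _ _ _ X)
    T0 L0 z1 g1 zg half uA.
  apply: (le_trans H).
  rewrite lee_fin lerXn2r ?nnegrE ?mulr_ge0 ?expR_ge0 ?invr_ge0 ?(ltW z0)//.
  have h : expR (lambda%:num * C) <= 2.
    apply: (@le_trans _ _ (expR 2^-1)).
      by rewrite ler_expR -ler_pdivlMr// ltW.
    have := expR_ge1Dx (- 2^-1 : R); rewrite expRN => h.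
    have e0 := expR_gt0 (2^-1 : R).
    have e1 : expR 2^-1 * (expR 2^-1)^-1 = 1 :> R by rewrite mulfV// gt_eqF.
    by nra.
  by rewrite ler_pdivrMl// /z mulfK// pnatr_eq0.
have mclosed := closed_site_measurable (ps_points X) (ps_walks X) L T0.
have [E [mE PE HE]] := reached_origin_event mclosed bound.
have [B [mB PB HB]] := Hdet.
(* Outside [E] some admissible target escapes, so such outcomes lie in the null event [B] given by
   almost sure detection. Then [B] and [E] cover the whole space, which their probabilities forbid;
   measurability of the escape event itself is never invoked. *)
have : (ps_prob X (B `|` E) < 1)%E.
  apply: le_lt_trans (measureU2 _ mB mE) _.
  by rewrite [X in (X + _)%E](_ : _ = 0%E) ?add0e.
rewrite (_ : B `|` E = setT) ?probability_setT ?ltxx//.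
apply/seteqP; split => // w _; have [Ew|nEw] := pselect (E w); [by right|left].
apply: HB => /= alldet.
have [F [F0 Fopen FL]] : exists F : nat -> nat, [/\ F 0%N = 0%N,
    forall i, ~ closed_site (ps_eta0 X) (ps_zeta X) L T (i, F i) w &
    forall i, (F i.+1 <= (F i).+1)%N /\ (F i <= (F i.+1).+1)%N].
  apply: (@lipschitz_open_path (fun a => closed_site (ps_eta0 X) (ps_zeta X) L T a w)).
  by move=> r; apply: nEw; exact: HE.
have tauS : 2 / S = 2 / S :> R by [].
have := alldet _ (target_speed d L0 F0 FL S0 tauS).
rewrite /Tdet (_ : [set t%:E | t in _] = set0) ?ereal_inf0 ?ltxx//.
apply/seteqP; split => // _ [t [/= t0 [j [x [ex gt]]]] _].
have [m [m1 m2 mb]] := target_box d L0 F0 FL S0 tauS t0.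
have TE : (2 * L)%:R * (2 / S) = T by rewrite /T natrM; field; rewrite gt_eqF.
rewrite TE in m1 m2.
(* A meeting at a real time [t] is moved to a rational time of the same block at which the particle
   has the same position; the target's own position at that time is irrelevant, since [touch] refers
   to the box only. *)
have [q [q1 q2 q3]] := walk_rational_time w (ps_walks X j) t0 m2.
apply: (Fopen m); exists j, x; split => //; exists q; split => //.
  exact: le_trans q1.
by rewrite q3 -gt.
Qed.
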